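(* There exist finitely presentable groups of genus $1$.
   Context: Let $P=\langle x_1,\dots,x_n \mid r_1,\dots,r_k\rangle$ be a finite presentation, with generators and relators ordered, the relators being words in the letters $x_i^{\pm1}$. \emph{The closed surface $\Omega_P$.} Let $d_i$ be the total number of occurrences of $x_i^{\pm1}$ in the concatenated word $r_1r_2\cdots r_k$ (powers are written out as repeated letters). Number these occurrences from left to right by $p=1,\dots,d_i$, and write the $p$-th one as $x_{i,p}^{\epsilon_{i,p}}$ with $\epsilon_{i,p}\in\{1,-1\}$. For each $i$ take two oriented discs $D_i^+$ and $D_i^-$ ($2n$ discs in all). On the boundary of $D_i^{+}$ place $d_i$ disjoint attaching arcs (''legs'') labelled $x_{i,1}^{+},\dots,x_{i,d_i}^{+}$ in this cyclic order with respect to the boundary orientation, and on the boundary of $D_i^-$ place $d_i$ legs labelled $x_{i,1}^{-},\dots,x_{i,d_i}^{-}$ in the opposite cyclic order. Whenever the occurrence $x_{i,p}^{\epsilon_{i,p}}$ is immediately followed, cyclically within some relator, by the occurrence $x_{j,q}^{\epsilon_{j,q}}$, attach a ribbon (a strip $[0,1]\times[0,1]$) joining the leg with label $x_{i,p}$ and sign $\epsilon_{i,p}$ to the leg with label $x_{j,q}$ and sign $-\epsilon_{j,q}$, in the way compatible with the orientations of the discs. Every leg then receives exactly one ribbon end, and the result is a compact oriented surface with boundary. Gluing a disc to each boundary component gives a closed orientable surface $\Omega_P$, possibly disconnected. \emph{Shuffles.} A shuffle of $P$ consists of a permutation $\sigma_i\in S_{d_i}$ for each $i$. The corresponding surface $\Omega'_P$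 is built in the same way, except that the legs on $D_i^+$ are placed in the cyclic order $x_{i,\sigma_i(1)}^{+},\dots,x_{i,\sigma_i(d_i)}^{+}$ and those on $D_i^-$ in the opposite cyclic order $x_{i,\sigma_i(d_i)}^{-},\dots,x_{i,\sigma_i(1)}^{-}$ (the reordering is made simultaneously on the two discs of each pair). The pairs of legs joined by ribbons are unchanged. \emph{Genus.} The genus of a closed orientable surface, possibly disconnected, is the sum of the genera of its connected components. The \emph{genus of a group} $G$ is the minimum genus of $\Omega'_P$ over all finite presentations $P$ of $G$ and all shuffles of $P$. *)

(* Defs.v *)
(* MathComp world *)
From HB Require Import structures.
From mathcomp Require Import all_boot all_order all_fingroup all_algebra.

Set Implicit Arguments.
Unset Strict Implicit.
Unset Printing Implicit Defensive.

(* The letter (i, true) is x_i and (i, false) is x_i^-1. *)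
Definition word (n : nat) := seq ('I_n * bool).

Record presentation := Presentation {
  ngen : nat;
  nrel : nat;
  relator : 'I_nrel -> word ngen }.

Definition eval_word (G : groupType) (n : nat) (f : 'I_n -> G) (w : word n) : G :=
  (\prod_(l <- w) (if l.2 then f l.1 else (f l.1)^-1))%g.

(* The congruence on words whose quotient is the group presented by P. *)
Inductive pres_eq (P : presentation) : word (ngen P) -> word (ngen P) -> Prop :=
| pres_refl w : pres_eq w w
| pres_sym u v : pres_eq u v -> pres_eq v u
| pres_trans u v w : pres_eq u v -> pres_eq v w -> pres_eq u w
| pres_cat u u' v v' : pres_eq u u' -> pres_eq v v' -> pres_eq (u ++ v) (u' ++ v')
| pres_cancel i b : pres_eq [:: (i, b); (i, ~~ b)] [::]
| pres_relator a : pres_eq (relator a) [::].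

(* Evaluation induces an isomorphism from the group presented by P onto G. *)
Definition presents (P : presentation) (G : groupType) : Prop :=
  exists f : 'I_(ngen P) -> G,
    (forall g : G, exists w, eval_word f w = g) /\
    (forall u v, eval_word f u = eval_word f v <-> pres_eq u v).

Definition finitely_presentable (G : groupType) : Prop :=
  exists P : presentation, presents P G.

Section Surface.
Variable P : presentation.

(* Pairs (relator, position in it); [enum] lists them in the order in which they
   appear in the concatenated word r_1 ... r_k, see [enum_occurrence]. *)
Definition occurrence := {a : 'I_(nrel P) & 'I_(size (relator a))}.

Definition letter (o : occurrence) : 'I_(ngen P) * bool :=
  tnth (in_tuple (relator (tag o))) (tagged o).

Lemma enum_occurrence :
  map letter (enum {: occurrence}) = flatten [seq relator a | a <- enum 'I_(nrel P)].
Proof.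
have -> : enum {: occurrence} =
    flatten [seq [seq (Tagged (fun a => 'I_(size (relator a))) b : occurrence)
                 | b <- enum 'I_(size (relator a))] | a <- enum 'I_(nrel P)].
  by rewrite [LHS]enumT [in LHS]unlock /= /tag_enum -!enumT;
     congr flatten; apply: eq_map => a; rewrite -enumT.
rewrite map_flatten -map_comp; congr flatten.
apply: eq_map => a /=; rewrite -map_comp.
exact: (map_tnth_enum (in_tuple (relator a))).
Qed.

Definition next_occ (o : occurrence) : occurrence :=
  Tagged (fun a => 'I_(size (relator a))) (ordS (tagged o)).

Definition prev_occ (o : occurrence) : occurrence :=
  Tagged (fun a => 'I_(size (relator a))) (ord_pred (tagged o)).

Definition occ_of (i : 'I_(ngen P)) : {set occurrence} :=
  [set o | (letter o).1 == i].

Definition nocc (i : 'I_(ngen P)) : nat := #|occ_of i|.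

(* The p-th occurrence x_{i,p}, counting from 0. *)
Definition occ_at (i : 'I_(ngen P)) (p : 'I_(nocc i)) : occurrence := enum_val p.

Definition shuffle := forall i : 'I_(ngen P), 'S_(nocc i).

(* The disc (i, true) is D_i^+ and (i, false) is D_i^-; likewise the leg
   (x_{i,p}, true) is x_{i,p}^+ and (x_{i,p}, false) is x_{i,p}^-. *)
Definition disc := ('I_(ngen P) * bool)%type.
Definition leg := (occurrence * bool)%type.

Definition disc_of (l : leg) : disc := ((letter l.1).1, l.2).

(* The leg at the other end of the ribbon attached to a given leg. *)
Definition ribbon (l : leg) : leg :=
  if l.2 == (letter l.1).2
  then (next_occ l.1, ~~ (letter (next_occ l.1)).2)
  else (prev_occ l.1, (letter (prev_occ l.1)).2).

Variable s : shuffle.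

Definition disc_legs (u : disc) : seq leg :=
  let c := [seq (occ_at (s u.1 p), u.2) | p <- enum 'I_(nocc u.1)] in
  if u.2 then c else rev c.

Definition next_leg (l : leg) : leg := next (disc_legs (disc_of l)) l.

(* A leg l also stands for the boundary arc of its disc going from l to the
   next leg.  With the orientations respected, the boundary of the ribbon
   surface follows this arc to [next_leg l] and then a side of the ribbon there,
   whose other end is the start of the arc of [ribbon (next_leg l)]. *)
Definition boundary_step (l : leg) : leg := ribbon (next_leg l).

Definition adjacent : rel disc :=
  [rel u v | [exists l : leg, (disc_of l == u) && (disc_of (ribbon l) == v)]].

(* A connected component is represented by the set of its discs. *)
Definition components : {set {set disc}} :=
  equivalence_partition (connect adjacent) [set: disc].

(* Each occurrence o gives one ribbon, leaving from the leg of o whose sign is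
   the exponent of o. *)
Definition nribbons (C : {set disc}) : nat :=
  #|[set o : occurrence | disc_of (o, (letter o).2) \in C]|.

(* The boundary of a disc without legs is a boundary component by itself. *)
Definition nboundaries (C : {set disc}) : nat :=
  fcard boundary_step [pred l | disc_of l \in C] +
  #|[set u in C | nocc u.1 == 0]|.

Local Open Scope ring_scope.

Definition euler_char (C : {set disc}) : int :=
  (#|C|)%:Z - (nribbons C)%:Z + (nboundaries C)%:Z.

(* The closed orientable surface of genus g has Euler characteristic 2 - 2g. *)
Definition component_genus (C : {set disc}) : int :=
  ((2 - euler_char C) %/ 2)%Z.

Definition surface_genus : int := \sum_(C in components) component_genus C.

End Surface.

Local Open Scope ring_scope.

Definition group_has_genus (G : groupType) (g : int) : Prop :=
  (exists (P : presentation) (s : shuffle P),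
     presents P G /\ surface_genus s = g) /\
  (forall (P : presentation) (s : shuffle P),
     presents P G -> g <= surface_genus s).

(* Main.v *)
(** The group is G = Z/2 x Z/2. The presentation <x, y | x^2, y^2, (xy)^2> has genus
    at most 1 with its legs in the given order.

    For the lower bound, gluing D_i^+ to D_i^- and then doing surgery along the
    relators turns a surface of genus 0 into a closed surface S (the boundary of a
    3-manifold with fundamental group G). It is cellulated by the boundary discs
    (faces), the arcs between consecutive legs (edges) and the two sides of each
    relator (vertices). Let Z be the space of 1-cocycles of S and Y the larger space
    of 1-cochains whose coboundary takes opposite values on the two sides of each
    relator. In terms of numbers of connected components, dim Y - dim Z <= n for
    n generators, over every field, and equality forces H^1(S) = 0.

    Over the rationals, the functions on generators embed in Y/Z since Hom(G, Q) = 0;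
    this is the equality case, so H^1(S) = 0, and then also over F_2. Hence the two
    coordinates a, b of G have primitives on S, and these yield elements of Y
    representing the classes aa, ab, bb of H^2(G; F_2). Together with the functions
    on generators they span a subspace of Y/Z of dimension n + 3 - 2 > n, because
    no nontrivial extension class in H^2(G; F_2) is zero and because Hom(G, F_2)
    has dimension 2: a contradiction. *)

From HB Require Import structures.
Require Import Defs.
From mathcomp Require Import all_boot all_order all_fingroup all_algebra.
From mathcomp Require Import zify ring.

Set Implicit Arguments.
Unset Strict Implicit.
Unset Printing Implicit Defensive.

Import Order.TTheory GRing.Theory Num.Theory.

Local Open Scope ring_scope.

(** * Dimension counts for linear maps *)

Lemma linear_linfunE (K : fieldType) (aT rT : vectType K) (f : aT -> rT) :
  linear f -> linfun f =1 f.
Proof.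
move=> f_lin.
pose fL : {linear aT -> rT} :=
  HB.pack f (GRing.isLinear.Build _ _ _ _ f f_lin).
exact: (lfunE fL).
Qed.

Lemma dim_fun (K : fieldType) (T : finType) :
  \dim {: {ffun T -> K^o}} = #|T|.
Proof. by rewrite dimvf /dim /= muln1. Qed.

Lemma dim_fun_triple (K : fieldType) (T : finType) :
  \dim {: ({ffun T -> K^o} * (K^o * K^o * K^o))%type} = (#|T| + 3)%N.
Proof.
have dim_pair (U W : vectType K) : \dim {: (U * W)%type} = (\dim {: U} + \dim {: W})%N.
  by rewrite !dimvf.
have dim_reg : \dim {: K^o} = 1%N by rewrite dimvf.
by rewrite !dim_pair dim_fun dim_reg.
Qed.

(** [f] induces an injection of [U] modulo the preimage of [Z] into the quotient [Y / Z], and this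
    preimage lies in [W]. *)
Lemma dim_le_preim (K : fieldType) (aT rT : vectType K) (f : 'Hom(aT, rT))
    (U : {vspace aT}) (Y Z : {vspace rT}) (W : {vspace aT}) :
  (Z <= Y)%VS ->
  (forall u, u \in U -> f u \in Y) ->
  (forall u, u \in U -> f u \in Z -> u \in W) ->
  (\dim U + \dim Z <= \dim W + \dim Y)%N.
Proof.
move=> sZY fY fW.
have sfY : (f @: U + Z <= Y)%VS.
  rewrite subv_add sZY andbT; apply/subvP => _ /memv_imgP[u uU ->]; exact: fY.
have sUW : (U :&: lker f <= W)%VS.
  apply/subvP => u; rewrite memv_cap memv_ker => /andP[uU /eqP fu].
  by apply: fW => //; rewrite fu mem0v.
have sUW' : (U :&: (f @^-1: Z) <= W)%VS.
  apply/subvP => u; rewrite memv_cap => /andP[uU].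
  by rewrite -memv_preim; apply: fW.
have := dimvS sUW'; have := dimvS sfY.
have := limg_ker_dim f U; have := limg_ker_dim f (U :&: (f @^-1: Z)).
have := dimv_sum_cap (f @: U) Z.
have -> : (U :&: (f @^-1: Z) :&: lker f = U :&: lker f)%VS.
  apply/vspaceP => u; rewrite !memv_cap -andbA; congr (_ && _).
  rewrite andbC memv_ker -memv_preim; case: eqP => //= ->; exact: mem0v.
have -> : (f @: (U :&: (f @^-1: Z)) = f @: U :&: Z)%VS.
  apply/vspaceP => y; rewrite memv_cap; apply/memv_imgP/andP.
    by case=> u; rewrite memv_cap -memv_preim => /andP[uU fuZ] ->; rewrite memv_img.
  case=> /memv_imgP[u uU ->] fuZ; exists u => //.
  by rewrite memv_cap uU -memv_preim.
lia.
Qed.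

(** * Orthogonal complements for the standard bilinear form *)

Section Dot.
Variables (K : fieldType) (T : finType).
Local Notation V := {ffun T -> K^o}.

Definition dot (u v : V) : K := \sum_x u x * v x.

Lemma dot_linear u : linear (dot u : V -> K^o).
Proof.
move=> a v w; rewrite /dot scaler_sumr -big_split; apply: eq_bigr => x _ /=.
rewrite !ffunE /= /GRing.scale /=; ring.
Qed.

Lemma dotC u v : dot u v = dot v u.
Proof. by apply: eq_bigr => x _; rewrite mulrC. Qed.

Lemma dotDl u v w : dot (u + v) w = dot u w + dot v w.
Proof. by rewrite -big_split; apply: eq_bigr => x _; rewrite ffunE mulrDl. Qed.

Lemma dot_nondeg u : (forall v, dot u v = 0) -> u = 0.
Proof.
move=> u0; apply/ffunP => x; rewrite ffunE.
have := u0 [ffun y => (y == x)%:R]; rewrite /dot (bigD1 x) //= ffunE eqxx mulr1.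
rewrite big1 ?addr0 // => y /negPf yx; by rewrite ffunE yx mulr0.
Qed.

Definition dots (U : {vspace V}) (w : V) : {ffun 'I_(\dim U) -> K^o} :=
  [ffun i : 'I_(\dim U) => dot (vbasis U)`_i w].

Lemma dots_linear (U : {vspace V}) : linear (dots U).
Proof. by move=> a v w; apply/ffunP => i; rewrite !ffunE dot_linear. Qed.

End Dot.

HB.lock Definition perp (K : fieldType) (T : finType) (U : {vspace {ffun T -> K^o}}) :
  {vspace {ffun T -> K^o}} := lker (linfun (dots U)).

Section Perp.
Variables (K : fieldType) (T : finType).
Local Notation V := {ffun T -> K^o}.

Lemma mem_perp (U : {vspace V}) w : reflect (forall u, u \in U -> dot u w = 0) (w \in perp U).
Proof.
rewrite perp.unlock memv_ker (linear_linfunE (@dots_linear _ _ U)).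
apply: (iffP eqP) => [/ffunP w0 u uU | w0].
  rewrite (coord_vbasis uU) /dot.
  transitivity (\sum_(i < \dim U) coord (vbasis U) i u * dots U w i); last first.
    by apply: big1 => i _; rewrite w0 ffunE mulr0.
  under eq_bigr => x _ do rewrite sum_ffunE mulr_suml.
  rewrite exchange_big; apply: eq_bigr => i _; rewrite ffunE mulr_sumr.
  by apply: eq_bigr => x _; rewrite ffunE mulrA.
apply/ffunP => i; rewrite !ffunE; apply: w0; apply: vbasis_mem.
by rewrite mem_nth // size_tuple.
Qed.

Lemma dim_le_pairing (U W : {vspace V}) :
  (forall u, u \in U -> u \in perp W -> u = 0) -> (\dim U <= \dim W)%N.
Proof.
move=> U0.
have UW0 : (U :&: perp W = 0)%VS.
  apply/eqP; rewrite -subv0; apply/subvP => u.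
  by rewrite memv_cap memv0 => /andP[uU uW]; apply/eqP/U0.
rewrite perp.unlock in UW0; rewrite -(limg_dim_eq UW0) (leq_trans (dimvS (subvf _))) // dim_fun.
by rewrite card_ord.
Qed.

(** Over a finite field [U] may meet [perp U], so [U] is compared with a complement of [perp U]. A
    vector of [U] orthogonal to that complement is orthogonal to everything, hence zero; the two
    spaces thus pair nondegenerately. *)
Lemma dim_perp (U : {vspace V}) : (\dim U + \dim (perp U) = #|T|)%N.
Proof.
have dW : (\dim (perp U)^C + \dim (perp U) = #|T|)%N.
  by rewrite dimv_compl dim_fun subnK // -(dim_fun K) dimvS ?subvf.
suff : (\dim (perp U)^C = \dim U)%N by lia.
apply/eqP; rewrite eqn_leq; apply/andP; split; apply: dim_le_pairing => u uU uW.
  apply/eqP; rewrite -memv0 -(capv_compl (perp U)) memv_cap uW; exact: uU.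
apply: dot_nondeg => v.
have : v \in (perp U + (perp U)^C)%VS by rewrite addv_complf memvf.
case/memv_addP => v1 v1P [v2 v2P ->].
rewrite dotC dotDl [dot v1 u]dotC (mem_perp _ _ v1P) // add0r.
exact: (mem_perp _ _ uW).
Qed.

End Perp.

(** * Functions constant along a relation *)

Section InvDiff.
Variables (K : fieldType) (T : finType).
Local Notation V := {ffun T -> K^o}.

Definition inv_diff (e : rel T) (g : V) : {ffun T * T -> K^o} :=
  [ffun p => if e p.1 p.2 then g p.1 - g p.2 else 0].

Lemma inv_diff_linear (e : rel T) : linear (inv_diff e).
Proof.
move=> a v w; apply/ffunP => p; rewrite !ffunE; case: ifP => _; last first.
  by rewrite scaler0 addr0.
rewrite /GRing.scale /=; ring.
Qed.

End InvDiff.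

HB.lock Definition invfun (K : fieldType) (T : finType) (e : rel T) :
  {vspace {ffun T -> K^o}} := lker (linfun (@inv_diff K T e)).

Section Inv.
Variables (K : fieldType) (T : finType).
Local Notation V := {ffun T -> K^o}.
Local Notation invfun := (invfun K).

Lemma mem_inv (e : rel T) (g : V) : reflect (forall x y, e x y -> g x = g y) (g \in invfun e).
Proof.
rewrite invfun.unlock memv_ker (linear_linfunE (@inv_diff_linear _ _ e)).
apply: (iffP eqP) => [/ffunP g0 x y exy | g0].
  by have := g0 (x, y); rewrite !ffunE /= exy => /eqP; rewrite subr_eq0 => /eqP.
by apply/ffunP => p; rewrite !ffunE; case: ifP => // /g0 ->; rewrite subrr.
Qed.

Lemma inv_connect (e : rel T) (g : V) x y : g \in invfun e -> connect e x y -> g x = g y.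
Proof.
move/mem_inv=> ge /connectP[p]; elim: p x => [|z p IHp] x /=; first by move=> _ ->.
by case/andP=> /ge -> /IHp; apply.
Qed.

Lemma inv_fconnectP (f : T -> T) (g : V) :
  reflect (forall x, g (f x) = g x) (g \in invfun (frel f)).
Proof.
apply: (iffP (mem_inv _ _)) => [gf x | gf x y /eqP <-]; last by rewrite gf.
by rewrite -(gf x (f x)) //=.
Qed.

Lemma inv_capE (e1 e2 : rel T) : (invfun e1 :&: invfun e2 = invfun (relU e1 e2))%VS.
Proof.
apply/vspaceP => g; rewrite memv_cap; apply/andP/mem_inv.
  by case=> /mem_inv g1 /mem_inv g2 x y /orP[/g1 | /g2].
by move=> g12; split; apply/mem_inv => x y exy; apply: g12; rewrite /= exy ?orbT.
Qed.

(** Restriction to the roots and extension from them are both injective. Component counts thereby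
    become dimensions, the same over every field. *)
Lemma dim_inv (e : rel T) : connect_sym e -> \dim (invfun e) = n_comp e T.
Proof.
move=> se; pose R := {x | roots e x}.
have -> : n_comp e T = #|{: R}|.
  by rewrite card_sig; apply: eq_card => x; rewrite !inE andbT.
rewrite -(dim_fun K).
pose res (g : V) : {ffun R -> K^o} := [ffun r => g (val r)].
have res_lin : linear res by move=> a v w; apply/ffunP => r; rewrite !ffunE.
pose rt x : R := exist (fun y => is_true (roots e y)) _ (roots_root se x).
pose ext (h : {ffun R -> K^o}) : V := [ffun x => h (rt x)].
have ext_lin : linear ext by move=> a v w; apply/ffunP => r; rewrite !ffunE.
apply/eqP; rewrite eqn_leq; apply/andP; split.
  have inj : (invfun e :&: lker (linfun res) = 0)%VS.
    apply/eqP; rewrite -subv0; apply/subvP => g.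
    rewrite memv_cap memv0 memv_ker (linear_linfunE res_lin).
    move=> /andP[ge /eqP/ffunP g0]; apply/eqP/ffunP => x; rewrite (inv_connect ge (connect_root e x)).
    by have := g0 (rt x); rewrite !ffunE.
  by rewrite -(limg_dim_eq inj) dimvS ?subvf.
have inj : (fullv :&: lker (linfun ext) = 0)%VS.
  apply/eqP; rewrite -subv0; apply/subvP => h.
  rewrite memv_cap memv_ker memv0 (linear_linfunE ext_lin) => /andP[_ /eqP/ffunP h0].
  apply/eqP/ffunP => r; have := h0 (val r); rewrite !ffunE => <-.
  by congr (h _); apply: val_inj => /=; apply/esym/eqP/(valP r).
rewrite -(limg_dim_eq inj) dimvS //; apply/subvP => _ /memv_imgP[h _ ->].
rewrite (linear_linfunE ext_lin); apply/mem_inv => x y exy; rewrite !ffunE.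
congr (h _); apply: val_inj => /=; apply/(fingraph.rootP se); exact: connect1.
Qed.

End Inv.

(** * Cochains on a combinatorial map whose vertices come in pairs *)

(** [s] selects one point of each pair [x], [f x], so the two halves of the sum cancel in every
    characteristic, 2 included. *)
Lemma sum_antisym (R : zmodType) (T : finType) (f : T -> T) (s : pred T) (F : T -> R) :
  involutive f -> (forall x, s (f x) = ~~ s x) -> (forall x, F (f x) = - F x) ->
  \sum_x F x = 0.
Proof.
move=> fK sf Ff; rewrite (bigID s) /= [X in _ + X](reindex_inj (inv_inj fK)) /=.
rewrite [X in _ + X](eq_big s (fun x => - F x)).
- by rewrite sumrN subrr.
- by move=> x; rewrite sf negbK.
- by move=> x _.
Qed.

(* The boundary of the handlebody, surgered along the relators, as a combinatorial
   map on the legs: [l] is the arc of its disc from [l] to [nx l], [rv] reverses it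
   (an arc of D_i^+ is glued to one of D_i^-), the orbits of [tr] are the vertices
   (the two sides of each relator, exchanged by [fl]) and those of [fc] the faces. *)
Section Maps.
Variables (L : finType) (nx rb fl : L -> L) (sg fw : pred L).
Hypotheses (rbK : involutive rb) (flK : involutive fl).
Hypothesis nx_fl : forall l, nx (fl (nx l)) = fl l.
Hypotheses (sg_nx : forall l, sg (nx l) = sg l) (sg_fl : forall l, sg (fl l) = ~~ sg l).
Hypotheses (fw_fl : forall l, fw (fl l) = ~~ fw l).
Hypothesis (fw_rb : forall l, fw (rb l) = ~~ fw l).

Let rv l := fl (nx l).
Let tr l := rb (fl l).
Let fc l := rb (nx l).

Let rvK : involutive rv.
Proof. by move=> l; rewrite /rv nx_fl flK. Qed.

Let tr_inj : injective tr.
Proof. exact: inj_comp (inv_inj rbK) (inv_inj flK). Qed.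

Let nx_inj : injective nx.
Proof. by move=> l l' /(congr1 fl) /(inv_inj rvK). Qed.

Let fc_inj : injective fc.
Proof. exact: inj_comp (inv_inj rbK) nx_inj. Qed.

Let fc_rv l : fc (rv l) = tr l.
Proof. by rewrite /fc /rv nx_fl. Qed.

Let tr_rv l : tr (rv l) = fc l.
Proof. by rewrite /tr /rv flK. Qed.

Let sg_rv l : sg (rv l) = ~~ sg l.
Proof. by rewrite sg_fl sg_nx. Qed.

Let rv_sym : connect_sym (frel rv) := fconnect_sym (inv_inj rvK).
Let fl_sym : connect_sym (frel fl) := fconnect_sym (inv_inj flK).
Let tr_sym : connect_sym (frel tr) := fconnect_sym tr_inj.
Let fc_sym : connect_sym (frel fc) := fconnect_sym fc_inj.

(** [E], [F], [M] count edges, faces and vertices, [S] the components of the surgered surface, [k]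
    the nonempty relators (both sides together), and [c] the components once the two sides of every
    relator are joined again. *)
Let E := n_comp (frel rv) L.
Let F := n_comp (frel fc) L.
Let M := n_comp (frel tr) L.
Let S := n_comp (relU (frel tr) (frel rv)) L.
Let k := n_comp (relU (frel tr) (frel fl)) L.
Let c := n_comp (relU (relU (frel tr) (frel fl)) (frel rv)) L.

Section Field.
Variable K : fieldType.
Local Notation V := {ffun L -> K^o}.
Local Notation invfun f := (invfun K (frel f)).

(** Cochains of the dual cellulation, with functions on faces in degree 0. Orthogonality to
    [invfun rv] is antisymmetry under reversal of edges; orthogonality to [invfun tr] says that the
    sum around each vertex vanishes. *)
Definition cocycles : {vspace V} := perp (invfun rv + invfun tr).
(** Here only the total over the two sides of each relator has to vanish. *)
Definition sided_cocycles : {vspace V} := perp (invfun rv + (invfun tr :&: invfun fl)).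
Definition cobord (g : V) : V := [ffun l => g (rv l) - g l].

Lemma cobord_linear : linear cobord.
Proof.
move=> a v w; apply/ffunP => l; rewrite !ffunE /GRing.scale /=; ring.
Qed.

Definition coboundaries : {vspace V} := (linfun cobord @: invfun fc)%VS.

Lemma mem_perp_add (U W : {vspace V}) y :
  (y \in perp (U + W)) = (y \in perp U) && (y \in perp W).
Proof.
apply/mem_perp/andP => [y0 | [/mem_perp yU /mem_perp yW] _ /memv_addP[u uU [w wW ->]]].
  by split; apply/mem_perp => u uU; apply: y0; apply: subvP uU; rewrite ?addvSl ?addvSr.
by rewrite dotDl yU // yW // addr0.
Qed.

Lemma mem_cocycles y :
  (y \in cocycles) = (y \in perp (invfun rv)) && (y \in perp (invfun tr)).
Proof. exact: mem_perp_add. Qed.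

Lemma mem_sided_cocycles y : (y \in sided_cocycles) =
  (y \in perp (invfun rv)) && (y \in perp (invfun tr :&: invfun fl)%VS).
Proof. exact: mem_perp_add. Qed.

Lemma antisym_perp (y : V) : (forall l, y (rv l) = - y l) -> y \in perp (invfun rv).
Proof.
move=> yN; apply/mem_perp => u /inv_fconnectP ur.
apply: (sum_antisym rvK sg_rv) => l; by rewrite ur yN mulrN.
Qed.

(** [rv l] and [tr l] lie in the same face, so the values [g (tr l) - g l] telescope around a
    vertex. *)
Lemma coboundary_cocycle : (coboundaries <= cocycles)%VS.
Proof.
apply/subvP => _ /memv_imgP[g /inv_fconnectP gf ->].
rewrite (linear_linfunE cobord_linear) mem_cocycles antisym_perp /=; last first.
  by move=> l; rewrite !ffunE rvK opprB.
apply/mem_perp => u /inv_fconnectP ut.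
rewrite /dot; under eq_bigr => l _ do rewrite ffunE -gf fc_rv mulrBr -{1}ut.
by rewrite sumrB [X in _ - X](reindex_inj tr_inj) subrr.
Qed.

Lemma cocycle_sided : (cocycles <= sided_cocycles)%VS.
Proof.
apply/subvP => y; rewrite mem_sided_cocycles mem_cocycles => /andP[-> /mem_perp y0].
by apply/mem_perp => u; rewrite memv_cap => /andP[/y0].
Qed.

Lemma inv_fc_rv : (invfun fc :&: invfun rv = invfun tr :&: invfun rv)%VS.
Proof.
apply/vspaceP => g; rewrite !memv_cap andbC [RHS]andbC.
case: inv_fconnectP => //= gr; apply/inv_fconnectP/inv_fconnectP => gf l.
  by rewrite -fc_rv gf gr.
by rewrite -tr_rv gf gr.
Qed.

Lemma dim_cocycles : (\dim cocycles + E + M = #|L| + S)%N.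
Proof.
have := dim_perp (invfun rv + invfun tr); have := dimv_sum_cap (invfun rv) (invfun tr).
rewrite capvC inv_capE !dim_inv -/E -/M -/S -/cocycles; first by lia.
all: by do ?apply: relU_sym.
Qed.

Lemma dim_sided_cocycles : (\dim sided_cocycles + E + k = #|L| + c)%N.
Proof.
have := dim_perp (invfun rv + (invfun tr :&: invfun fl)).
have := dimv_sum_cap (invfun rv) (invfun tr :&: invfun fl).
rewrite [(invfun rv :&: _)%VS]capvC -/sided_cocycles !inv_capE !dim_inv -/E -/k -/c; first by lia.
all: by do ?apply: relU_sym.
Qed.

Lemma dim_coboundaries : (\dim coboundaries + S = F)%N.
Proof.
have := limg_ker_dim (linfun cobord) (invfun fc).
have -> : (invfun fc :&: lker (linfun cobord) = invfun fc :&: invfun rv)%VS.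
  apply/vspaceP => g; rewrite !memv_cap; congr (_ && _).
  rewrite memv_ker (linear_linfunE cobord_linear).
  apply/eqP/inv_fconnectP => [/ffunP g0 l | g0].
    by have /eqP := g0 l; rewrite !ffunE subr_eq0 => /eqP.
  by apply/ffunP => l; rewrite !ffunE g0 subrr.
rewrite inv_fc_rv inv_capE -/coboundaries !dim_inv -/F -/S; first by rewrite addnC.
all: by do ?apply: relU_sym.
Qed.

(* Both sides of a relator carry the same data, exchanged by [fl]. *)
Lemma dim_inv_tr : (M <= k + k)%N.
Proof.
have <- : \dim (invfun tr) = M by rewrite dim_inv.
have <- : \dim (invfun tr :&: invfun fl)%VS = k.
  by rewrite inv_capE dim_inv //; apply: relU_sym.
pose side b (g : V) : V := [ffun l => g (if fw l == b then l else fl l)].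
have side_lin b : linear (side b) by move=> a v w; apply/ffunP => l; rewrite !ffunE.
have fw_tr l : fw (tr l) = fw l by rewrite fw_rb fw_fl negbK.
have sideP b g : g \in invfun tr -> side b g \in (invfun tr :&: invfun fl)%VS.
  move=> /inv_fconnectP gt; rewrite memv_cap; apply/andP; split; apply/inv_fconnectP => l.
    rewrite !ffunE fw_tr; case: ifP => _; first exact: gt.
    by rewrite -[LHS]gt /tr flK rbK.
  by rewrite !ffunE fw_fl flK; case: (fw l) b => [] [].
have img b : (linfun (side b) @: invfun tr <= invfun tr :&: invfun fl)%VS.
  by apply/subvP => _ /memv_imgP[g gt ->]; rewrite (linear_linfunE (side_lin b)) sideP.
rewrite -(limg_ker_dim (linfun (side true)) (invfun tr)).
set A := (invfun tr :&: lker _)%VS.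
rewrite leq_add ?(dimvS (img true)) // (leq_trans _ (dimvS (img false))) //.
have AP g : g \in A -> g \in invfun tr /\ forall l, fw l -> g l = 0.
  rewrite /A memv_cap => /andP[gt]; rewrite memv_ker (linear_linfunE (side_lin true)).
  move=> /eqP/ffunP g0; split=> // l fl_; by have := g0 l; rewrite !ffunE fl_.
have inj : (A :&: lker (linfun (side false)) = 0)%VS.
  apply/eqP; rewrite -subv0; apply/subvP => g.
  rewrite memv_cap memv0 => /andP[/AP[gt g1]].
  rewrite memv_ker (linear_linfunE (side_lin false)) => /eqP/ffunP g0.
  apply/eqP/ffunP => l; rewrite ffunE; case fwl: (fw l); first exact: g1.
  by have := g0 l; rewrite !ffunE fwl.
by rewrite -(limg_dim_eq inj) dimvS // limgS // capvSl.
Qed.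

Section Labels.
Variable a : L -> K.
Hypotheses (a_nx : forall l, a (nx l) = a l) (a_fl : forall l, a (fl l) = a l).

Definition label_cochain : V := [ffun l => if sg l then a l else - a l].

(** [fl] keeps the label and reverses the sign, so the two sides of a relator contribute opposite
    sums. *)
Lemma label_cochain_sided : label_cochain \in sided_cocycles.
Proof.
have a_rv l : a (rv l) = a l by rewrite a_fl a_nx.
rewrite mem_sided_cocycles antisym_perp /=; last first.
  by move=> l; rewrite !ffunE sg_rv a_rv; case: (sg l); rewrite ?opprK.
apply/mem_perp => u; rewrite memv_cap => /andP[_ /inv_fconnectP ufl].
apply: (sum_antisym flK sg_fl) => l; rewrite !ffunE sg_fl a_fl ufl.
by case: (sg l); rewrite ?mulrN ?opprK.
Qed.

Hypothesis two0 : 1 + 1 = 0 :> K.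

Variable b : L -> K.
Hypotheses (b_nx : forall l, b (nx l) = b l) (b_fl : forall l, b (fl l) = b l).
Variable g : V.

(* A cochain with coboundary the cup product of [a] and [b] when [g] is a
   primitive of [a]; the second term accounts for inverse letters. *)
Definition cup_cochain : V := [ffun l => g l * b l + (sg l)%:R * (a l * b l)].

(** Since [tr l] is in the face of [rv l], reading one letter of a relator adds its label to the
    primitive. *)
Lemma primitive_tr l : g \in invfun fc -> cobord g = [ffun l => a l] -> g (tr l) = g l + a l.
Proof.
move=> /inv_fconnectP gf /ffunP/(_ l); rewrite !ffunE -fc_rv gf.
by move/(canRL (subrK _)) ->; rewrite addrC.
Qed.

(** Adding the two sides of a relator leaves [b] times a discrepancy between the values of [g] on
    them. This discrepancy is constant along the relator, where the cocycle [b] sums to zero. *)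
Lemma cup_cochain_sided :
  g \in invfun fc -> cobord g = [ffun l => a l] -> [ffun l => b l] \in cocycles ->
  cup_cochain \in sided_cocycles.
Proof.
move=> g_inv ga b_coc; have gtr l := primitive_tr l g_inv ga.
have gf := inv_fconnectP _ _ g_inv.
have a_rv l : a (rv l) = a l by rewrite a_fl a_nx.
have b_rv l : b (rv l) = b l by rewrite b_fl b_nx.
have grv l : g (rv l) = g l + a l by rewrite -gtr -fc_rv gf.
rewrite mem_sided_cocycles antisym_perp /=; last first.
  move=> l; rewrite !ffunE sg_rv grv a_rv b_rv; apply/eqP; rewrite -addr_eq0.
  case: (sg l); apply/eqP; set x := g l; set y := a l; set z := b l.
    transitivity ((1 + 1) * (x * z + y * z)); by [rewrite /=; ring | rewrite two0 mul0r].
  transitivity ((1 + 1) * (x * z + y * z)); by [rewrite /=; ring | rewrite two0 mul0r].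
apply/mem_perp => u; rewrite memv_cap => /andP[/inv_fconnectP ut /inv_fconnectP ufl].
(* The term [a l] compensates for [tr] running in opposite directions on the two sides. *)
pose kap l := g l + g (fl l) + a l.
have kap_tr l : kap (tr l) = kap l.
  rewrite /kap gtr; have := gtr (fl (tr l)).
  rewrite {1}/tr flK {1}/tr rbK a_fl => ->; ring.
(* Cutting down to the [fw] side keeps invariance under [tr], so [v] can be tested against the
   cocycle [b]. *)
pose v : V := [ffun l => (fw l)%:R * (u l * kap l)].
have v_tr : v \in invfun tr.
  by apply/inv_fconnectP => l; rewrite !ffunE ut kap_tr fw_rb fw_fl negbK.
move: b_coc; rewrite mem_cocycles => /andP[_ /mem_perp/(_ v v_tr) vb].
rewrite /dot (bigID fw) /= [X in _ + X](reindex_inj (inv_inj flK)) /=.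
rewrite [X in _ + X](eq_bigl fw); last by move=> l; rewrite fw_fl negbK.
rewrite -big_split -[RHS]vb /dot [RHS](bigID fw) /= [X in _ = _ + X]big1 ?addr0.
  apply: eq_bigr => l fwl; rewrite !ffunE fwl ufl sg_fl a_fl b_fl /kap.
  case: (sg l) => /=; ring.
by move=> l /negPf fwl; rewrite !ffunE fwl !mul0r.
Qed.

End Labels.
End Field.

(* [spheres] is [2 c <= chi] for a surface made of [n.*2] discs, [E] ribbons and
   [F] boundary discs. *)
Variable n : nat.
Hypotheses (L_E : #|L| = E.*2) (spheres : (E + c.*2 <= n.*2 + F)%N).

(** Let [Y] be the sided cocycles, [Z] the cocycles and [h] the dimension of [Z] modulo
    coboundaries. The dimension formulas, [dim_inv_tr] and [spheres] give [h + 2 (dim Y - dim Z) = E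
    - F + 2 c + M - 2 k <= 2 n]. These counts do not depend on the field, so equality over [K0]
    forces [h = 0] over [K]. *)
Lemma cocycle_coboundary (K0 K : fieldType) :
  (n + \dim (cocycles K0) <= \dim (sided_cocycles K0))%N ->
  cocycles K = coboundaries K.
Proof.
move=> n_le; apply/eqP; rewrite eq_sym eqEdim coboundary_cocycle /=.
have := dim_cocycles K0; have := dim_sided_cocycles K0.
have := dim_cocycles K; have := dim_coboundaries K; have := dim_inv_tr K.
lia.
Qed.

(** The same inequality, with [h >= 0]. *)
Lemma dim_sided_le (K : fieldType) :
  (\dim (sided_cocycles K) <= n + \dim (cocycles K))%N.
Proof.
have := dimvS (coboundary_cocycle K).
have := dim_cocycles K; have := dim_coboundaries K; have := dim_inv_tr K.
have := dim_sided_cocycles K; lia.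
Qed.

End Maps.

(** * Parity of orbit counts, through signs of permutations *)

Lemma fcard_involution (T : finType) (f : T -> T) (a : {pred T}) :
  involutive f -> (forall x, f x != x) -> fclosed f a -> (fcard f a * 2 = #|a|)%N.
Proof.
move=> fK f_neq a_cl; apply: (fcard_order_set (inv_inj fK)) => //.
apply/subsetP => x _; rewrite inE.
have f_cycle : fcycle f [:: x; f x] by rewrite /= fK !eqxx.
rewrite (order_cycle f_cycle) ?mem_head //= inE eq_sym; exact/andP.
Qed.

Lemma fconnect_porbit (T : finType) (s : {perm T}) x y :
  fconnect s x y = (y \in porbit s x).
Proof.
apply/idP/porbitP => [/iter_findex <- | [i ->]].
  by exists (findex s x y); rewrite permX.
by rewrite permX fconnect_iter.
Qed.

Lemma card_porbits_fcard (T : finType) (s : {perm T}) : #|porbits s| = fcard s T.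
Proof.
have s_sym := fconnect_sym (@perm_inj T s).
have -> : porbits s = porbit s @: [set x | froots s x].
  apply/setP => X; apply/imsetP/imsetP => -[x _ ->]; last by exists x.
  exists (froot s x); first by rewrite inE roots_root.
  by apply/eqP; rewrite eq_sym eq_porbit_mem -fconnect_porbit connect_root.
rewrite card_in_imset.
  by apply: eq_card => x; rewrite !inE andbT.
move=> x y; rewrite !inE => /eqP xr /eqP yr /eqP; rewrite eq_porbit_mem -fconnect_porbit.
by move=> /(fingraph.rootP s_sym); rewrite xr yr.
Qed.

Section RestrictedSign.
Variables (T : finType) (a : {pred T}).

(** Extending by the identity outside [a] gives a permutation of [T], whose sign sees only the
    orbits in [a]. *)
Definition restrict (f : T -> T) x := if x \in a then f x else x.

Lemma restrict_inj f : injective f -> fclosed f a -> injective (restrict f).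
Proof.
move=> f_inj a_cl x y; rewrite /restrict.
have af z : (f z \in a) = (z \in a) by rewrite -(a_cl z (f z)) //=.
case: ifPn => xa; case: ifPn => ya //; first exact: f_inj.
  by move=> fxy; move: ya; rewrite -fxy af xa.
by move=> fxy; move: xa; rewrite fxy af ya.
Qed.

Lemma connect_restrict f x :
  x \in a -> fclosed f a -> fconnect (restrict f) x =1 fconnect f x.
Proof.
move=> xa a_cl y.
have af z : (f z \in a) = (z \in a) by rewrite -(a_cl z (f z)) //=.
have iterE i : iter i (restrict f) x = iter i f x /\ iter i f x \in a.
  elim: i => [|i [IHe IHa]] //=; by rewrite IHe af /restrict IHa.
apply/idP/idP => /iter_findex <-.
  by rewrite (iterE _).1 fconnect_iter.
by rewrite -(iterE _).1 fconnect_iter.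
Qed.

Lemma odd_restrict f (f_inj : injective f) (a_cl : fclosed f a) :
  odd_perm (perm (restrict_inj f_inj a_cl)) = odd #|a| (+) odd (fcard f a).
Proof.
set s := perm _; rewrite /odd_perm card_porbits_fcard.
have sE : s =1 restrict f by move=> x; rewrite permE.
have -> : fcard s T = (fcard f a + #|[predC a]|)%N.
  rewrite (n_compC a); congr (_ + _)%N; apply: eq_card => x; rewrite !inE.
    case xa: (x \in a); rewrite ?andbF // !andbT /roots /fingraph.root.
    congr (odflt _ _ == _); apply: eq_pick => y.
    by rewrite (eq_fconnect sE) connect_restrict.
  case xa: (x \in a); rewrite ?andbF // !andbT.
  have sx : s x = x by rewrite sE /restrict xa.
  have : fconnect s x (froot s x) by exact: connect_root.
  move=> /iter_findex; rewrite (_ : iter _ s x = x) => [rx|].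
    by rewrite /roots -rx eqxx.
  by elim: (findex _ _ _) => //= i ->.
by rewrite -(cardC a) !oddD; case: (odd #|a|); case: (odd (fcard f a)); case: odd.
Qed.

(** Multiplicativity of the sign. Applied to discs, ribbons and boundary curves, it makes the Euler
    characteristic even. *)
Lemma odd_fcard_comp f g :
  injective f -> injective g -> fclosed f a -> fclosed g a ->
  ~~ odd (fcard f a + fcard g a + fcard (g \o f) a + #|a|).
Proof.
move=> f_inj g_inj f_cl g_cl.
have h_inj := inj_comp g_inj f_inj.
have h_cl : fclosed (g \o f) a.
  move=> x _ /eqP <-; by rewrite (f_cl x (f x)) //= (g_cl (f x) (g (f x))) /=.
have : perm (restrict_inj h_inj h_cl) =
       (perm (restrict_inj f_inj f_cl) * perm (restrict_inj g_inj g_cl))%g.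
  apply/permP => x; rewrite permM !permE /restrict.
  case: ifPn => xa; last by rewrite (negPf xa).
  by rewrite -(f_cl x (f x)) //= xa.
move=> /(congr1 (@odd_perm T)); rewrite odd_permM !odd_restrict !oddD.
by do 4 case: odd.
Qed.

End RestrictedSign.

(** * The surface of a presentation as a combinatorial map *)

Section Surfaces.
Variables (P : presentation) (s : shuffle P).
Local Notation L := (leg P).
Local Notation nx := (@next_leg P s).
Local Notation rb := (@ribbon P).

Definition flip (l : L) : L := (l.1, ~~ l.2).
Definition sgn (l : L) : bool := l.2.
(* The orbits of [ribbon \o flip] follow the relators: forwards on these legs,
   backwards on the others. *)
Definition forward (l : L) : bool := l.2 == ~~ (letter l.1).2.

Lemma next_occK : cancel (@next_occ P) (@prev_occ P).
Proof. by case=> i j; rewrite /prev_occ /next_occ /= ordSK. Qed.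

Lemma prev_occK : cancel (@prev_occ P) (@next_occ P).
Proof. by case=> i j; rewrite /prev_occ /next_occ /= ord_predK. Qed.

Lemma ribbonK : involutive rb.
Proof.
case=> o b; rewrite /ribbon /=; case: (b =P (letter o).2) => [-> | /eqP bo] /=.
  by rewrite eq_sym next_occK; case: (letter (next_occ o)).2.
rewrite eqxx prev_occK; congr (_, _); by case: b (letter o).2 bo => [] [].
Qed.

Lemma flipK : involutive flip.
Proof. by case=> o b; rewrite /flip negbK. Qed.

Lemma forward_ribbon l : forward (rb l) = ~~ forward l.
Proof.
case: l => o b; rewrite /ribbon /forward /=; case: (b =P (letter o).2) => [->|/eqP] /=.
  by rewrite eqxx; case: (letter o).2.
by case: (letter (prev_occ o)).2; case: b (letter o).2 => [] [].
Qed.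

Lemma forward_flip l : forward (flip l) = ~~ forward l.
Proof. by case: l => o b; rewrite /forward /=; case: b (letter o).2 => [] []. Qed.

Lemma ribbon_neq l : rb l != l.
Proof.
by apply/eqP => /(congr1 forward); rewrite forward_ribbon; case: (forward l).
Qed.

Lemma mem_disc_legs (u : disc P) l : (l \in disc_legs s u) = (disc_of l == u).
Proof.
have -> : (l \in disc_legs s u) =
    (l \in [seq (occ_at (s u.1 p), u.2) | p <- enum 'I_(nocc u.1)]).
  by case: u => i [] //; rewrite /disc_legs /= mem_rev.
case: l u => o b [i d] /=; apply/mapP/eqP => [[p _ [-> ->]] | [io ->]] /=.
  have := enum_valP (s i p); rewrite inE => /eqP li.
  by congr (_, _).
have oi : o \in occ_of i by rewrite inE io.
exists ((s i)^-1%g (enum_rank_in oi o)); first by rewrite mem_enum.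
by rewrite permKV /occ_at enum_rankK_in.
Qed.

Lemma uniq_disc_legs (u : disc P) : uniq (disc_legs s u).
Proof.
rewrite /disc_legs; case: ifP => _; rewrite ?rev_uniq map_inj_uniq ?enum_uniq //.
all: by move=> p q [] /enum_val_inj /perm_inj.
Qed.

Lemma disc_of_next l : disc_of (nx l) = disc_of l.
Proof. by apply/eqP; rewrite -mem_disc_legs mem_next mem_disc_legs. Qed.

Lemma sgn_next l : sgn (nx l) = sgn l.
Proof. exact: (congr1 snd (disc_of_next l)). Qed.

Lemma disc_legs_flip (u : disc P) :
  disc_legs s (u.1, ~~ u.2) = rev (map flip (disc_legs s u)).
Proof.
by case: u => i []; rewrite /disc_legs /= ?map_rev ?revK -[in RHS]map_comp.
Qed.

Lemma flip_inj : injective flip. Proof. exact: inv_inj flipK. Qed.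

(** A shuffle reorders both discs of a pair simultaneously, so their legs stay in opposite orders
    and [flip] conjugates [next_leg] to its inverse. *)
Lemma next_flip l : nx (flip (nx l)) = flip l.
Proof.
rewrite {1}/next_leg.
have -> : disc_of (flip (nx l)) = ((disc_of l).1, ~~ (disc_of l).2).
  by rewrite -[in RHS]disc_of_next.
rewrite disc_legs_flip next_rev ?(map_inj_uniq flip_inj) ?uniq_disc_legs //.
by rewrite (prev_map flip_inj) ?uniq_disc_legs // prev_next ?uniq_disc_legs.
Qed.

Lemma next_inj : injective nx.
Proof. by move=> l l' /(congr1 (fun m => flip (nx (flip m)))); rewrite !next_flip !flipK. Qed.

Lemma fconnect_next l l' : fconnect nx l l' = (disc_of l == disc_of l').
Proof.
set p := disc_legs s (disc_of l).
have p_cycle : fcycle nx p.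
  apply: (@sub_in_cycle _ (mem p) (frel (next p))).
  - by move=> x y; rewrite !mem_disc_legs /= /next_leg => /eqP -> _.
  - exact/allP.
  - exact/cycle_next/uniq_disc_legs.
by rewrite (fconnect_cycle p_cycle) ?mem_disc_legs // eq_sym.
Qed.

Lemma adjacent_sym : symmetric (@adjacent P).
Proof.
suff adj u v : @adjacent P u v -> @adjacent P v u by move=> u v; apply/idP/idP; apply: adj.
rewrite /adjacent /= => /existsP[l /andP[/eqP <- /eqP <-]]; apply/existsP; exists (rb l).
by rewrite ribbonK !eqxx.
Qed.

Let adj_sym := sym_connect_sym adjacent_sym.

Lemma components_partition : partition (components P) [set: disc P].
Proof.
apply: equivalence_partitionP => u v w _ _ _; split; first exact: connect0.
by move=> uv; apply: (same_connect adj_sym uv).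
Qed.

Lemma component_connect C u v :
  C \in components P -> u \in C -> connect (@adjacent P) u v -> v \in C.
Proof.
move=> /imsetP[w _ ->]; rewrite !inE; exact: connect_trans.
Qed.

Lemma component_ribbon C l :
  C \in components P -> (disc_of (rb l) \in C) = (disc_of l \in C).
Proof.
move=> CP; suff imp m : disc_of m \in C -> disc_of (rb m) \in C.
  by apply/idP/idP => /imp; rewrite ?ribbonK.
move=> mC; apply: component_connect mC _ => //; apply: connect1.
by rewrite /adjacent /=; apply/existsP; exists m; rewrite !eqxx.
Qed.

Lemma sum_components (T : finType) (h : T -> disc P) (A : pred T) :
  (\sum_(C in components P) #|[pred x | A x & h x \in C]| = #|A|)%N.
Proof.
case/and3P: components_partition => /eqP cov triv _.
rewrite -sum1_card (partition_big (fun x => pblock (components P) (h x)) (mem (components P))) /=.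
  apply: eq_bigr => C CP; rewrite -sum1_card; apply: eq_bigl => x.
  rewrite !inE; congr (_ && _).
  apply/idP/eqP => [hC | <-]; first exact: def_pblock.
  by rewrite mem_pblock cov.
by move=> x _; rewrite pblock_mem ?cov.
Qed.

Definition isolated : {set disc P} := [set u | nocc u.1 == 0%N].

(** Orbits of [next_leg] are the discs that carry a leg; the others must be added by hand. *)
Lemma card_discs (C : {set disc P}) :
  (#|C| = fcard nx [pred l | disc_of l \in C] + #|[set u in C | nocc u.1 == 0%N]|)%N.
Proof.
rewrite -(cardsID isolated C) addnC; congr (_ + _)%N; last first.
  by apply: eq_card => u; rewrite !inE andbC.
pose X := [set l | froots nx l & disc_of l \in C].
have nx_sym := fconnect_sym next_inj.
have -> : C :\: isolated = @disc_of P @: X.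
  apply/setP => u; rewrite !inE; apply/andP/imsetP => [[u0 uC] | [l]].
    have [o ou] : exists o, o \in occ_of u.1.
      by apply/set0Pn; rewrite -card_gt0 lt0n.
    have lu : disc_of (o, u.2) = u.
      by move: ou; rewrite inE => /eqP ou; case: u ou {u0 uC} => i b /= <-.
    have := connect_root (frel nx) (o, u.2); rewrite fconnect_next lu => /eqP ur.
    by exists (froot nx (o, u.2)); rewrite // inE roots_root // -ur.
  rewrite inE => /andP[_ lC] ->; split=> //=.
  by rewrite -lt0n card_gt0; apply/set0Pn; exists l.1; rewrite inE.
rewrite card_in_imset; first by apply: eq_card => l; rewrite !inE.
move=> l l'; rewrite !inE => /andP[/eqP lr _] /andP[/eqP lr' _] /eqP.
by rewrite -fconnect_next => /(fingraph.rootP nx_sym); rewrite lr lr'.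
Qed.

Lemma fcard_ribbon (C : {set disc P}) : C \in components P ->
  fcard rb [pred l | disc_of l \in C] = nribbons C.
Proof.
move=> CP; set a := [pred l | _].
have a_cl : fclosed rb a by move=> l _ /eqP <-; rewrite !inE component_ribbon.
have := fcard_involution ribbonK ribbon_neq a_cl.
suff -> : #|a| = (nribbons C * 2)%N by move=> /eqP; rewrite eqn_pmul2r // => /eqP.
(* Exactly one end of a ribbon is not [forward]: the end at the occurrence that it leaves. *)
have half : #|[predD a & [pred l | forward l]]| = nribbons C.
  pose start (o : occurrence P) : L := (o, (letter o).2).
  have start_inj : injective start by move=> o o' [].
  rewrite /nribbons -(card_imset _ start_inj); apply: eq_card => -[o b].
  rewrite !inE /forward /=; apply/andP/imsetP => [[bo obC] | [o' o'C [-> ->]]].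
    have bE : b = (letter o).2 by case: b (letter o).2 bo {obC} => [] [].
    by exists o; rewrite /start ?bE // inE -bE.
  by rewrite inE in o'C; rewrite o'C; case: (letter o').2.
have swap : #|[predI a & [pred l | forward l]]| = #|[predD a & [pred l | forward l]]|.
  rewrite -!sum1_card (reindex_inj (inv_inj ribbonK)); apply: eq_bigl => l.
  by rewrite !inE component_ribbon // forward_ribbon andbC.
by rewrite -(cardID [pred l | forward l] a) swap half muln2 addnn.
Qed.

(** This makes the division in [component_genus] exact. It holds because [boundary_step] is [ribbon]
    after [next_leg], and signs multiply. *)
Lemma even_euler_char (C : {set disc P}) :
  C \in components P -> (2 %| euler_char s C)%Z.
Proof.
move=> CP; pose a := [pred l | disc_of l \in C].
have nx_cl : fclosed nx a by move=> l _ /eqP <-; rewrite !inE disc_of_next.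
have rb_cl : fclosed rb a by move=> l _ /eqP <-; rewrite !inE component_ribbon.
have := odd_fcard_comp next_inj (inv_inj ribbonK) nx_cl rb_cl.
have := fcard_involution ribbonK ribbon_neq rb_cl.
have := card_discs C; rewrite /a (fcard_ribbon CP) /euler_char /nboundaries.
rewrite -[fcard (boundary_step s) _]/(fcard (rb \o nx) _).
(* The [i] legless discs count both as discs and as boundary components, so they contribute an even
   number. *)
have aux (e v f d i l : nat) : d = (v + i)%N -> (e * 2)%N = l ->
    ~~ odd (v + e + f + l) -> (2 %| d%:Z - e%:Z + (f + i)%:Z)%Z.
  move=> -> <- even; apply/dvdzP; exists ((v + e + f + e * 2)./2%:Z + i%:Z - (e * 2)%:Z).
  have := odd_double_half (v + e + f + e * 2); rewrite (negPf even); lia.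
exact: aux.
Qed.

Lemma double_surface_genus : surface_genus s * 2 = 
  (#|components P|.*2 + #|{: occurrence P}|)%:Z
  - (ngen P * 2 + fcard (boundary_step s) {: L} + #|isolated|)%:Z.
Proof.
rewrite /surface_genus mulr_suml.
have genusE C : C \in components P ->
    component_genus s C * 2 = (2 + nribbons C)%:Z - (#|C| + nboundaries s C)%:Z.
  move=> /even_euler_char; rewrite /component_genus /euler_char; lia.
have sum_discs : (\sum_(C in components P) #|C| = ngen P * 2)%N.
  have -> : (ngen P * 2 = #|{: disc P}|)%N by rewrite card_prod card_ord card_bool.
  by rewrite -(sum_components id predT); apply: eq_bigr => C _; apply: eq_card => u.
have sum_ribbons : (\sum_(C in components P) nribbons C = #|{: occurrence P}|)%N.
  rewrite -(sum_components (fun o => disc_of (o, (letter o).2)) predT).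
  by apply: eq_bigr => C _; apply: eq_card => u; rewrite !inE.
have sum_faces : (\sum_(C in components P) nboundaries s C =
    fcard (boundary_step s) {: L} + #|isolated|)%N.
  rewrite big_split -(sum_components id (mem isolated)); congr (_ + _)%N; last first.
    by apply: eq_bigr => C _; apply: eq_card => u; rewrite !inE andbC.
  transitivity #|[pred l : L | froots (boundary_step s) l]|.
    rewrite -(sum_components (@disc_of P) (froots (boundary_step s))).
    by apply: eq_bigr => C _; apply: eq_card => u; rewrite !inE.
  by apply: eq_card => u; rewrite !inE andbT.
rewrite (eq_bigr _ genusE) sumrB -!(big_morph _ PoszD (erefl _)).
rewrite 2!big_split /= sum_nat_const sum_discs sum_ribbons sum_faces.
by rewrite muln2 addnA.
Qed.

Lemma card_legs : #|{: L}| = (#|{: occurrence P}| * 2)%N.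
Proof. by rewrite card_prod card_bool. Qed.

Lemma card_arcs : #|{: L}| = (fcard (fun l => flip (nx l)) {: L}).*2.
Proof.
have rvK : involutive (fun l => flip (nx l)) by move=> l; rewrite next_flip flipK.
rewrite -muln2 fcard_involution // => l.
by apply/eqP => /(congr1 sgn); rewrite -(sgn_next l) /sgn /=; case: (nx l).2.
Qed.

(** Gluing each D_i^+ to D_i^- can only merge components: the listed moves generate [flip],
    [next_leg] and [ribbon], hence connect any two legs in the same component of the surface. *)
Lemma n_comp_le_components :
  (n_comp (relU (relU (frel (fun l => rb (flip l))) (frel flip))
                (frel (fun l => flip (nx l)))) {: L} <= #|components P|)%N.
Proof.
set e := relU _ _.
have e_sym : connect_sym e.
  do 2 ?apply: relU_sym; apply: fconnect_sym.
  - exact: inj_comp (inv_inj ribbonK) flip_inj.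
  - exact: flip_inj.
  - exact: inj_comp flip_inj next_inj.
have e_flip l : connect e l (flip l) by apply: connect1; rewrite /= eqxx ?orbT.
have e_next l : connect e l (nx l).
  rewrite -(flipK (nx l)); apply: connect_trans (e_flip _).
  by apply: connect1; rewrite /= eqxx ?orbT.
have e_ribbon l : connect e l (rb l).
  apply: connect_trans (e_flip l) _; apply: connect1.
  by rewrite /= flipK eqxx ?orbT.
have e_disc l l' : disc_of l = disc_of l' -> connect e l l'.
  move=> /eqP; rewrite -fconnect_next => /iter_findex <-.
  elim: (findex _ _ _) => //= i IHi; exact: connect_trans IHi (e_next _).
have e_adj u v l l' : connect (@adjacent P) u v -> disc_of l = u -> disc_of l' = v ->
    connect e l l'.
  move=> /connectP[p]; elim: p u l => [|w p IHp] u l /=.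
    by move=> _ -> lu l'u; apply: e_disc; rewrite lu.
  case/andP=> /existsP[m /andP[/eqP mu /eqP mw]] pw vE lu l'v.
  apply: connect_trans (e_disc l m _) (connect_trans (e_ribbon m) _); first by rewrite lu.
  exact: IHp pw vE mw l'v.
case/and3P: components_partition => /eqP cov triv _.
pose X := [set l | roots e l]; pose block l := pblock (components P) (disc_of l).
have -> : n_comp e {: L} = #|X| by apply: eq_card => l; rewrite !inE andbT.
rewrite -(@card_in_imset _ _ block X).
  by apply/subset_leq_card/subsetP => _ /imsetP[l _ ->]; rewrite pblock_mem ?cov.
move=> l l'; rewrite !inE => /eqP lr /eqP lr' ll'.
suff : connect e l l' by move=> /(fingraph.rootP e_sym); rewrite lr lr'.
apply: (e_adj (disc_of l) (disc_of l')) => //.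
have Cl : block l \in components P by rewrite pblock_mem ?cov.
have lC : disc_of l \in block l by rewrite mem_pblock cov.
have : disc_of l' \in block l by rewrite ll' mem_pblock cov.
by case/imsetP: Cl lC => w _ ->; rewrite !inE /= adj_sym; apply: connect_trans.
Qed.

(** By [card_arcs] there are as many glued arcs as ribbons, namely one per occurrence, so the genus
    formula takes this form. *)
Lemma spheres_euler : isolated = set0 -> (surface_genus s <= 0)%R ->
  (fcard (fun l => flip (nx l)) {: L} + (#|components P|).*2 <=
   (ngen P).*2 + fcard (boundary_step s) {: L})%N.
Proof.
move=> iso0 g0; have := double_surface_genus; rewrite iso0 cards0.
have := card_arcs; rewrite card_legs; lia.
Qed.

End Surfaces.

(** * Homomorphisms and central extensions, evaluated on words *)

Section Words.
Variables (K : comRingType) (n : nat).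

Definition wsum (t : 'I_n -> K) (w : word n) : K :=
  \sum_(l <- w) (if l.2 then t l.1 else - t l.1).

Lemma wsum_cat t u v : wsum t (u ++ v) = wsum t u + wsum t v.
Proof. exact: big_cat. Qed.


(* In the central extension of [K * K] by [K] with 2-cocycle [cocyc], lift the
   generator [x_i], which maps to [(a i, b i)], to [(a i, b i, t i)]: [ext_word A B w]
   is the central component of [(A, B, 0)] times the value of the word [w]. *)
Variables (q1 q2 q3 : K) (a b t : 'I_n -> K).

Definition cocyc A B x y := q1 * A * x + q2 * A * y + q3 * B * y.

(** An inverse letter undoes the letter read from [(A - a i, B - b i)]. *)
Definition ext_letter A B (l : 'I_n * bool) :=
  let: (i, e) := l in
  if e then t i + cocyc A B (a i) (b i)
  else - t i - cocyc (A - a i) (B - b i) (a i) (b i).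

Fixpoint ext_word A B (w : word n) : K :=
  if w is l :: w' then
    ext_letter A B l + ext_word (A + if l.2 then a l.1 else - a l.1)
                                (B + if l.2 then b l.1 else - b l.1) w'
  else 0.

Lemma ext_word_cat A B u v :
  ext_word A B (u ++ v) = ext_word A B u + ext_word (A + wsum a u) (B + wsum b u) v.
Proof.
elim: u A B => [|l u IHu] A B /=; first by rewrite /wsum !big_nil !addr0 add0r.
by rewrite IHu /wsum !big_cons !addrA.
Qed.

(** Bilinearity of [cocyc]. The correction vanishes on words over which [a] and [b] sum to zero, so
    the base point will not matter on relators. *)
Lemma ext_word_shift A B w :
  ext_word A B w = ext_word 0 0 w + cocyc A B (wsum a w) (wsum b w).
Proof.
elim: w A B => [|[i e] w IHw] A B /=.
  by rewrite /wsum !big_nil /cocyc; ring.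
rewrite IHw [in RHS]IHw /wsum !big_cons -!/(wsum _ _) /cocyc /=.
case: e; ring.
Qed.

(** Only steps inside the word are constrained, since [A] and [B] will be read at the occurrences of
    a relator and mean nothing past its last letter. *)
Lemma ext_word_sum w (A B : nat -> K) :
  (forall j : 'I_(size w), (j.+1 < size w)%N ->
     A j.+1 = A j + (let l := tnth (in_tuple w) j in if l.2 then a l.1 else - a l.1) /\
     B j.+1 = B j + (let l := tnth (in_tuple w) j in if l.2 then b l.1 else - b l.1)) ->
  ext_word (A 0%N) (B 0%N) w =
  \sum_(j < size w) ext_letter (A j) (B j) (tnth (in_tuple w) j).
Proof.
elim: w A B => [|l w IHw] A B AB /=; first by rewrite big_ord0.
rewrite big_ord_recl; congr (_ + _).
case: w IHw AB => [|l' w] IHw AB; first by rewrite big_ord0.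
have [] := AB ord0 isT; rewrite (tnth_nth l) /= => <- <-.
apply: etrans (IHw (fun j => A j.+1) (fun j => B j.+1) _) _ => [j j_lt|].
  by have := AB (lift ord0 j) j_lt; rewrite !(tnth_nth l).
by apply: eq_bigr => j _; rewrite !(tnth_nth l).
Qed.

End Words.

Lemma wsum_pres_eq (K : comRingType) (P : presentation) (t : 'I_(ngen P) -> K) u v :
  (forall r, wsum t (relator r) = 0) -> pres_eq u v -> wsum t u = wsum t v.
Proof.
move=> t0; elim=> {u v} //.
- by move=> u v w _ -> _.
- by move=> u u' v v' _ IHu _ IHv; rewrite !wsum_cat IHu IHv.
- by move=> i e; rewrite /wsum !big_cons !big_nil; case: e => /=; rewrite addr0 ?subrr ?addNr.
- by move=> r; rewrite t0 /wsum big_nil.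
Qed.

Lemma ext_word_pres_eq (K : comRingType) (P : presentation)
    (q1 q2 q3 : K) (a b t : 'I_(ngen P) -> K) u v :
  (forall r, wsum a (relator r) = 0) -> (forall r, wsum b (relator r) = 0) ->
  (forall r, ext_word q1 q2 q3 a b t 0 0 (relator r) = 0) -> pres_eq u v ->
  ext_word q1 q2 q3 a b t 0 0 u = ext_word q1 q2 q3 a b t 0 0 v.
Proof.
move=> a0 b0 t0; elim=> {u v} //.
- by move=> u v w _ -> _.
- move=> u u' v v' uu' IHu vv' IHv; rewrite !ext_word_cat !add0r.
  rewrite [ext_word _ _ _ _ _ _ (wsum a u) _ _]ext_word_shift.
  rewrite [ext_word _ _ _ _ _ _ (wsum a u') _ _]ext_word_shift IHu IHv.
  by rewrite !(wsum_pres_eq a0 uu', wsum_pres_eq b0 uu', wsum_pres_eq a0 vv',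
               wsum_pres_eq b0 vv').
- move=> i e; rewrite /= /cocyc; case: e => /=; ring.
Qed.

(** * Sums of cochains along relators *)

Section RelatorSums.
Variables (P : presentation) (s : shuffle P) (K : fieldType).
Local Notation L := (leg P).
Local Notation V := {ffun L -> K^o}.
Local Notation cocycles := (cocycles (next_leg s) (@ribbon P) (@flip P) K).
Local Notation trace := (fun l : L => ribbon (flip l)).

Definition occ (r : 'I_(nrel P)) (j : 'I_(size (relator r))) : occurrence P :=
  Tagged (fun r => 'I_(size (relator r))) j.

Definition fwd (o : occurrence P) : L := (o, ~~ (letter o).2).
Definition bwd (o : occurrence P) : L := (o, (letter o).2).

Lemma trace_fwd o : trace (fwd o) = fwd (next_occ o).
Proof. by rewrite /ribbon /flip /= negbK eqxx. Qed.

Lemma trace_bwd o : trace (bwd o) = bwd (prev_occ o).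
Proof. by rewrite /ribbon /flip /=; case: (letter o).2. Qed.

Lemma sum_legs (F : L -> K) :
  \sum_l F l = \sum_r \sum_(j < size (relator r)) (F (fwd (occ j)) + F (bwd (occ j))).
Proof.
rewrite sig_big_dep /= (eq_bigr (fun l => F (l.1, l.2))); last by case.
rewrite -(pair_bigA _ (fun o b => F (o, b))) /=.
apply: eq_bigr => -[r j] _; rewrite big_bool /fwd /bwd /occ /=.
by case: (letter _).2 => //; rewrite addrC.
Qed.

Lemma next_occ_const (R : Type) (h : occurrence P -> R) :
  (forall o, h (next_occ o) = h o) ->
  forall r (i j : 'I_(size (relator r))), h (occ i) = h (occ j).
Proof.
move=> h_next r.
have all0 m (m_lt : (m < size (relator r))%N) (m0 : (0 < size (relator r))%N) :
    h (occ (Ordinal m_lt)) = h (occ (Ordinal m0)).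
  elim: m m_lt => [|m IHm] m_lt; first by congr (h (occ _)); apply: val_inj.
  rewrite -(IHm (ltnW m_lt)) -[RHS]h_next; congr h; rewrite /next_occ /occ /=.
  by congr (Tagged _ _); apply: val_inj; rewrite /= modn_small.
move=> [i i_lt] [j j_lt]; have m0 := leq_ltn_trans (leq0n i) i_lt.
by rewrite !(all0 _ _ m0).
Qed.

(** A function invariant under [trace] is constant on each side of each relator and factors out of
    the sums. *)
Lemma perp_traceP (y : V) :
  (forall r, \sum_(j < size (relator r)) y (fwd (occ j)) = 0) ->
  (forall r, \sum_(j < size (relator r)) y (bwd (occ j)) = 0) ->
  y \in perp (invfun K (frel trace)).
Proof.
move=> yf yb; apply/mem_perp => u /inv_fconnectP ut.
rewrite /dot sum_legs big1 // => r _; rewrite big_split /=.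
have uf : forall o, u (fwd (next_occ o)) = u (fwd o) by move=> o; rewrite -trace_fwd ut.
have ub : forall o, u (bwd (next_occ o)) = u (bwd o).
  by move=> o; rewrite -ut trace_bwd next_occK.
(* An empty relator has no occurrence at which to read the constants. *)
case: (posnP (size (relator r))) => [r0|r_gt0].
  rewrite !big1 ?addr0 // => j _; by have := ltn_ord j; rewrite {2}r0.
pose o0 := occ (Ordinal r_gt0).
rewrite (eq_bigr (fun j => u (fwd o0) * y (fwd (occ j)))); last first.
  by move=> j _; rewrite (next_occ_const uf j (Ordinal r_gt0)).
rewrite [X in _ + X](eq_bigr (fun j => u (bwd o0) * y (bwd (occ j)))); last first.
  by move=> j _; rewrite (next_occ_const ub j (Ordinal r_gt0)).
by rewrite -!mulr_sumr yf yb !mulr0 addr0.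
Qed.

Lemma cocycle_relator (y : V) r :
  y \in cocycles -> \sum_(j < size (relator r)) y (fwd (occ j)) = 0.
Proof.
rewrite mem_cocycles => /andP[_ /mem_perp y0].
pose u : V := [ffun l => (forward l && (tag l.1 == r))%:R].
have ut : u \in invfun K (frel trace).
  apply/inv_fconnectP => l; rewrite !ffunE forward_ribbon forward_flip negbK.
  by congr (_ && _)%:R; case: l => o b; rewrite /ribbon /=; case: ifP.
have := y0 u ut; rewrite /dot sum_legs (bigD1 r) //= [X in _ + X]big1 ?addr0.
  move=> sum0; rewrite -[RHS]sum0; apply: eq_bigr => j _; rewrite !ffunE /forward /= !eqxx mul1r.
  by case: (letter (occ j)).2; rewrite /= mul0r addr0.
move=> r' /negPf r'r; apply: big1 => j _.
by rewrite !ffunE /= r'r !andbF !mul0r addr0.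
Qed.

Variable t : 'I_(ngen P) -> K.

Definition label (l : L) : K := t (letter l.1).1.

Lemma label_next l : label (next_leg s l) = label l.
Proof. by congr (t _); have [] := disc_of_next s l. Qed.

Lemma label_flip l : label (flip l) = label l.
Proof. by []. Qed.

(** Its sums along the two sides of a relator are plus and minus the value of [t] there, so it is a
    cocycle exactly when [t] defines a homomorphism to [K]. *)
Definition gen_cochain : V := label_cochain (@sgn P) label.

Lemma sum_relator r (F : 'I_(ngen P) * bool -> K) :
  \sum_(j < size (relator r)) F (letter (occ j)) = \sum_(l <- relator r) F l.
Proof. by rewrite [RHS]big_tnth. Qed.

Lemma gen_cochain_bwd r :
  \sum_(j < size (relator r)) gen_cochain (bwd (occ j)) = wsum t (relator r).
Proof.
rewrite /wsum -(sum_relator r (fun l => if l.2 then t l.1 else - t l.1)).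
by apply: eq_bigr => j _; rewrite ffunE.
Qed.

Lemma gen_cochain_fwd r :
  \sum_(j < size (relator r)) gen_cochain (fwd (occ j)) = - wsum t (relator r).
Proof.
rewrite -gen_cochain_bwd -sumrN; apply: eq_bigr => j _; rewrite !ffunE /sgn /=.
by case: (letter (occ j)).2; rewrite /= ?opprK.
Qed.

Lemma gen_cochain_sided :
  gen_cochain \in sided_cocycles (next_leg s) (@ribbon P) (@flip P) K.
Proof.
exact: (label_cochain_sided _ (@flipK P) (next_flip s) (sgn_next s) (fun=> erefl)
          label_next label_flip).
Qed.

Lemma gen_cochain_cocycle :
  (forall r, wsum t (relator r) = 0) -> gen_cochain \in cocycles.
Proof.
move=> t0; have := gen_cochain_sided; rewrite mem_sided_cocycles mem_cocycles.
case/andP=> -> _; apply: perp_traceP => r.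
  by rewrite gen_cochain_fwd t0 oppr0.
by rewrite gen_cochain_bwd t0.
Qed.

Lemma cocycle_gen_cochain :
  gen_cochain \in cocycles -> forall r, wsum t (relator r) = 0.
Proof.
by move=> /cocycle_relator y0 r; apply/eqP; rewrite -oppr_eq0 -gen_cochain_fwd y0.
Qed.

End RelatorSums.

Lemma gen_cochain_linear (P : presentation) (K : fieldType) :
  linear (fun t : {ffun 'I_(ngen P) -> K^o} => @gen_cochain P K t).
Proof.
move=> c t t'; apply/ffunP => l; rewrite !ffunE /label !ffunE /GRing.scale /=.
by case: ifP => _; ring.
Qed.


(** * Cup products in characteristic 2 *)

Section CupProducts.
Variables (P : presentation) (s : shuffle P) (K : fieldType).
Hypothesis two0 : 1 + 1 = 0 :> K.
Local Notation L := (leg P).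
Local Notation V := {ffun L -> K^o}.
Local Notation cocycles := (cocycles (next_leg s) (@ribbon P) (@flip P) K).
Local Notation sided_cocycles := (sided_cocycles (next_leg s) (@ribbon P) (@flip P) K).
Local Notation faces := (frel (fun l : L => ribbon (next_leg s l))).
Local Notation cobord := (cobord (next_leg s) (@flip P)).

Lemma opp_char2 (x : K) : - x = x.
Proof. by apply/eqP; rewrite eq_sym -addr_eq0 -mulr2n -mulr_natr mulr2n two0 mulr0. Qed.

Lemma gen_cochain_char2 (t : 'I_(ngen P) -> K) :
  gen_cochain t = [ffun l => label t l].
Proof. by apply/ffunP => l; rewrite !ffunE opp_char2 if_same. Qed.

Definition cup (a b : 'I_(ngen P) -> K) (g : V) : V :=
  cup_cochain (@sgn P) (label a) (label b) g.

Variables (a b : 'I_(ngen P) -> K) (g h : V).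
Hypotheses (a_rel : forall r, wsum a (relator r) = 0).
Hypotheses (b_rel : forall r, wsum b (relator r) = 0).
Hypotheses (g_inv : g \in invfun K faces) (h_inv : h \in invfun K faces).
Hypotheses (ga : cobord g = gen_cochain a) (hb : cobord h = gen_cochain b).

Lemma cup_sided (c : 'I_(ngen P) -> K) :
  (forall r, wsum c (relator r) = 0) -> cup a c g \in sided_cocycles.
Proof.
move=> c_rel.
apply: (cup_cochain_sided (@ribbonK P) (@flipK P) (next_flip s) (sgn_next s)
  (fun=> erefl) (@forward_flip P) (@forward_ribbon P) (label_next s a)
  (label_flip a) two0 (label_next s c) (label_flip c) g_inv).
  by rewrite ga gen_cochain_char2.
by rewrite -gen_cochain_char2; apply: gen_cochain_cocycle.
Qed.

(** Along a relator a primitive of [c] runs through partial sums of [c], as the base points in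
    [ext_word] do. *)
Lemma gauge_step c (u : V) o :
  u \in invfun K faces -> cobord u = gen_cochain c ->
  u (fwd (next_occ o)) = u (fwd o) + (if (letter o).2 then c (letter o).1 else - c (letter o).1).
Proof.
move=> u_inv uc; rewrite opp_char2 if_same -trace_fwd.
exact: (primitive_tr (a := label c) (next_flip s) (fwd o) u_inv
          (etrans uc (gen_cochain_char2 c))).
Qed.

(** Summed along a relator, it gives the value of the relator in the central extension with cocycle
    [q1 aa + q2 ab + q3 bb] and generators lifted by [t]. *)
Definition quadratic_cochain (x : {ffun 'I_(ngen P) -> K^o} * (K^o * K^o * K^o)) : V :=
  @gen_cochain P K x.1 +
  (x.2.1.1 *: cup a a g + x.2.1.2 *: cup a b g + x.2.2 *: cup b b h).

Lemma quadratic_cochain_linear : linear quadratic_cochain.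
Proof.
move=> c [t [[q1 q2] q3]] [t' [[q1' q2'] q3']]; rewrite /quadratic_cochain /=.
rewrite gen_cochain_linear; move: (gen_cochain t) (gen_cochain t') => T T'.
move: (cup a a g) (cup a b g) (cup b b h) => C1 C2 C3.
apply/ffunP => l; rewrite !ffunE /GRing.scale /=; ring.
Qed.

Lemma cup_cocycle_ext_word (q1 q2 q3 : K) (t : {ffun 'I_(ngen P) -> K^o}) :
  quadratic_cochain (t, (q1, q2, q3)) \in cocycles ->
  forall r, ext_word q1 q2 q3 a b t 0 0 (relator r) = 0.
Proof.
move=> /cocycle_relator y0 r.
(* The default 0 enters only as the base point of an empty relator, where nothing is summed. *)
pose along (u : V) (j : nat) : K :=
  if insub j is Some i then u (fwd (occ (i : 'I_(size (relator r))))) else 0.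
have alongE u (j : 'I_(size (relator r))) : along u j = u (fwd (occ j)).
  by rewrite /along valK.
have alongS c u (j : 'I_(size (relator r))) :
    u \in invfun K faces -> cobord u = gen_cochain c -> (j.+1 < size (relator r))%N ->
    along u j.+1 = along u j +
      (let l := tnth (in_tuple (relator r)) j in if l.2 then c l.1 else - c l.1).
  move=> u_inv uc j_lt; rewrite alongE -[tnth _ j]/(letter (occ j)) -(gauge_step _ u_inv uc).
  rewrite -[j.+1]/(val (Ordinal j_lt)) alongE; congr (u (fwd _)).
  by rewrite /next_occ /occ; congr (Tagged _ _); apply: val_inj; rewrite /= modn_small.
(* The base point moves from the origin to the values of [g] and [h] at the first letter, at no cost
   on a relator. *)
have := ext_word_shift q1 q2 q3 a b t (along g 0%N) (along h 0%N) (relator r).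
rewrite a_rel b_rel /cocyc !mulr0 !addr0 => <-.
rewrite ext_word_sum => [|j j_lt]; last by split; apply: alongS.
rewrite -[RHS](y0 r); apply: eq_bigr => j _; rewrite !alongE !ffunE.
rewrite -[tnth _ j]/(letter (occ j)) /label /sgn /fwd /ext_letter /cocyc /=.
case: (letter (occ j)) => i e /=; rewrite /GRing.scale /= !opp_char2 if_same.
by case: e => /=; move: (g _) (h _) => G H; ring.
Qed.

End CupProducts.

(** * The lower bound for the Klein four-group *)

Definition klein : groupType := ('F_2 * 'F_2)%type.

Lemma addF2 (x : 'F_2) : x + x = 0.
Proof. by case: x => [] [|[]] // ?; apply: val_inj. Qed.

Section LowerBound.
Variables (P : presentation) (s : shuffle P) (f : 'I_(ngen P) -> klein).
Hypotheses (f_gen : forall x : klein, exists w, eval_word f w = x).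
Hypotheses (f_rel : forall u v, eval_word f u = eval_word f v <-> pres_eq u v).
Local Notation L := (leg P).
Local Notation n := (ngen P).
Local Notation cocycles := (cocycles (next_leg s) (@ribbon P) (@flip P)).
Local Notation sided_cocycles := (sided_cocycles (next_leg s) (@ribbon P) (@flip P)).

Let a (i : 'I_n) : 'F_2 := (f i).1.
Let b (i : 'I_n) : 'F_2 := (f i).2.

Lemma eval_klein (w : word n) : eval_word f w = (wsum a w, wsum b w).
Proof.
rewrite /eval_word /wsum; elim: w => [|[i e] w IHw]; first by rewrite !big_nil.
by rewrite !big_cons IHw; case: e => /=; rewrite /a /b; case: (f i).
Qed.

Lemma wsum_relator r : wsum a (relator r) = 0 /\ wsum b (relator r) = 0.
Proof.
have /f_rel := pres_relator r; rewrite !eval_klein.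
by rewrite /wsum !big_nil => -[-> ->].
Qed.

Lemma square_trivial (w : word n) : pres_eq (w ++ w) [::].
Proof.
apply/f_rel; rewrite !eval_klein !wsum_cat /wsum !big_nil.
by rewrite !addF2.
Qed.

Lemma hom_trivial (K : fieldType) (t : 'I_n -> K) :
  1 + 1 != 0 :> K -> (forall r, wsum t (relator r) = 0) -> forall i, t i = 0.
Proof.
move=> two_neq0 t_rel i; have := wsum_pres_eq t_rel (square_trivial [:: (i, true)]).
rewrite wsum_cat /wsum !big_cons !big_nil /= addr0 => tt.
apply/eqP; have : (1 + 1) * t i == 0 by rewrite mulrDl !mul1r tt.
by rewrite mulf_eq0 (negPf two_neq0).
Qed.

(** A generator occurring in no relator could be sent anywhere, giving a nonzero homomorphism to the
    rationals. *)
Lemma no_isolated : isolated P = set0.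
Proof.
apply/setP => -[i e]; rewrite !inE /=; apply/negP => /eqP occ0.
pose t (j : 'I_n) : rat := (j == i)%:R.
suff t_rel r : wsum t (relator r) = 0.
  by have := hom_trivial (t := t) isT t_rel i; rewrite /t eqxx.
rewrite /wsum big_tnth big1 // => j _.
suff /negPf ji : (tnth (in_tuple (relator r)) j).1 != i.
  by rewrite /t ji oppr0 if_same.
apply/negP => ji; have := card0_eq occ0 (occ j); rewrite inE; by rewrite ji.
Qed.

(** The functions on generators embed modulo cocycles, because those giving cocycles are
    homomorphisms to [K], hence zero. *)
Lemma dim_gen_cochains (K : fieldType) :
  1 + 1 != 0 :> K -> (n + \dim (cocycles K) <= \dim (sided_cocycles K))%N.
Proof.
move=> two_neq0.
pose theta (t : {ffun 'I_n -> K^o}) := @gen_cochain P K t.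
have theta_lin : linear theta := @gen_cochain_linear P K.
have := @dim_le_preim K _ _ (linfun theta) fullv (sided_cocycles K) (cocycles K) 0%VS.
rewrite dim_fun card_ord dimv0 add0n; apply.
- exact: cocycle_sided.
- by move=> t _; rewrite (linear_linfunE theta_lin); apply: gen_cochain_sided.
move=> t _; rewrite (linear_linfunE theta_lin) memv0 => /cocycle_gen_cochain t_rel.
by apply/eqP/ffunP => i; rewrite ffunE; apply: hom_trivial t_rel i.
Qed.

(* If all relators hold in the extension then it splits over [klein], so every
   lift of an element of [klein] squares to 1; on [(1, 0)], [(0, 1)] and [(1, 1)]
   this kills the cocycle. *)
Lemma ext_trivial (q1 q2 q3 : 'F_2) (t : 'I_n -> 'F_2) :
  (forall r, ext_word q1 q2 q3 a b t 0 0 (relator r) = 0) ->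
  [/\ q1 = 0, q2 = 0, q3 = 0 & exists x y, forall i, t i = x * a i + y * b i].
Proof.
move=> t_rel; pose ext := ext_word q1 q2 q3 a b t 0 0.
have a_rel r := (wsum_relator r).1; have b_rel r := (wsum_relator r).2.
have ext_eq := ext_word_pres_eq a_rel b_rel t_rel.
have ext_cat u v : ext (u ++ v) =
    ext u + ext v + cocyc q1 q2 q3 (wsum a u) (wsum b u) (wsum a v) (wsum b v).
  by rewrite /ext ext_word_cat !add0r [X in _ + X = _]ext_word_shift addrA.
(* The value of [w ++ w] is twice that of [w] plus this term, and squares are trivial. *)
have quad w : cocyc q1 q2 q3 (wsum a w) (wsum b w) (wsum a w) (wsum b w) = 0.
  by have := ext_eq _ _ (square_trivial w); rewrite -/ext ext_cat addF2 add0r.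
have [w1 w1E] := f_gen (1, 0); have [w2 w2E] := f_gen (0, 1).
have := quad w1; have := quad w2; have := quad (w1 ++ w2).
move: (w1E) (w2E); rewrite !eval_klein !wsum_cat => -[-> ->] [-> ->].
rewrite /cocyc !(mulr0, mulr1, addr0, add0r) => q123 q3_0 q1_0.
have q2_0 : q2 = 0 by move: q123; rewrite q1_0 q3_0 add0r addr0.
split=> //; exists (ext w1), (ext w2) => i.
have ext0 u v : ext (u ++ v) = ext u + ext v.
  by rewrite ext_cat /cocyc q1_0 q2_0 q3_0 !mul0r !addr0.
have power (c : 'F_2) w : exists w', [/\ ext w' = ext w * c,
    wsum a w' = wsum a w * c & wsum b w' = wsum b w * c].
  have [-> | ->] : c = 0 \/ c = 1.
  - by case: c => [] [|[]] // ?; [left | right]; apply: val_inj.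
  - by exists [::]; rewrite /wsum !big_nil !mulr0.
  - by exists w; rewrite !mulr1.
(* In the group, [x_i] is [w1] to the power [a i] times [w2] to the power [b i]. *)
have [v1 [v1t v1a v1b]] := power (a i) w1; have [v2 [v2t v2a v2b]] := power (b i) w2.
have eqv : pres_eq [:: (i, true)] (v1 ++ v2).
  apply/f_rel; rewrite !eval_klein !wsum_cat v1a v1b v2a v2b.
  move: w1E w2E; rewrite !eval_klein => -[-> ->] [-> ->].
  by rewrite /wsum !big_cons !big_nil /= !(mul1r, mul0r, addr0, add0r).
have := ext_eq _ _ eqv; rewrite -/ext ext0 v1t v2t => <-.
by rewrite /ext /= /cocyc q1_0 q2_0 q3_0 !mul0r !addr0.
Qed.

Lemma klein_genus_gt0 : 1 <= surface_genus s.
Proof.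
rewrite leNgt; apply/negP => genus_lt1.
have euler := spheres_euler no_isolated (ltac:(lia) : surface_genus s <= 0).
have comp_le := n_comp_le_components s; rewrite -leq_double in comp_le.
have {comp_le}euler := leq_trans (leq_add (leqnn _) comp_le) euler.
(* The equality case is reached over the rationals and exploited over ['F_2]. *)
have coc := cocycle_coboundary (@ribbonK P) (@flipK P) (next_flip s) (sgn_next s)
  (fun=> erefl) (@forward_flip P) (@forward_ribbon P) (card_arcs s) euler 'F_2
  (dim_gen_cochains (K := rat) isT).
have dimY := dim_sided_le (@ribbonK P) (@flipK P) (next_flip s) (sgn_next s)
  (fun=> erefl) (@forward_flip P) (@forward_ribbon P) (card_arcs s) euler 'F_2.
have two0 : 1 + 1 = 0 :> 'F_2 by exact: addF2.
have a_rel r := (wsum_relator r).1; have b_rel r := (wsum_relator r).2.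
have primitive c : (forall r, wsum c (relator r) = 0) ->
    exists2 g, g \in invfun 'F_2 (frel (fun l : L => ribbon (next_leg s l)))
      & cobord (next_leg s) (@flip P) g = gen_cochain c.
  move=> c_rel; have := gen_cochain_cocycle s c_rel; rewrite coc.
  case/memv_imgP => g g_inv; rewrite (linear_linfunE (@cobord_linear _ _ _ _)) => gc.
  by exists g.
have [g g_inv ga] := primitive a a_rel; have [h h_inv hb] := primitive b b_rel.
pose X := ({ffun 'I_n -> ('F_2)^o} * (('F_2)^o * ('F_2)^o * ('F_2)^o))%type.
pose theta := quadratic_cochain a b g h.
have theta_lin : linear theta := quadratic_cochain_linear a b g h.
(* The two coordinate homomorphisms account for the whole kernel modulo cocycles. *)
pose va : X := ([ffun i => a i], (0, 0, 0)).
pose vb : X := ([ffun i => b i], (0, 0, 0)).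
pose ab := [:: va; vb].
have dimX : \dim {: X} = (n + 3)%N.
  by rewrite dim_fun_triple card_ord.
have span2 := dim_span ab; rewrite /= in span2.
have := @dim_le_preim _ _ _ (linfun theta) fullv (sided_cocycles 'F_2)
  (cocycles 'F_2) <<ab>>%VS.
rewrite dimX => bound.
(* Together with [span2] and [dimY] this would give [n + 3 <= n + 2]. *)
suff : (n + 3 + \dim (cocycles 'F_2) <= \dim <<ab>> + \dim (sided_cocycles 'F_2))%N.
  lia.
apply: bound => [|x _|x _]; first exact: cocycle_sided.
  rewrite (linear_linfunE theta_lin) /theta /quadratic_cochain !memvD ?memvZ //.
  - exact: gen_cochain_sided.
  - exact: cup_sided g_inv ga _ a_rel.
  - exact: cup_sided g_inv ga _ b_rel.
  - exact: cup_sided h_inv hb _ b_rel.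
rewrite (linear_linfunE theta_lin); case: x => t [[q1 q2] q3].
move=> /(cup_cocycle_ext_word two0 a_rel b_rel g_inv h_inv ga hb) /ext_trivial.
move=> [/= -> -> -> [x [y t_ab]]].
have -> : (t, (0, 0, 0)) = x *: va + y *: vb.
  congr (_, _); first by apply/ffunP => i; rewrite !ffunE t_ab.
  by congr (_, _, _); rewrite -[RHS]/(x * 0 + y * 0) !mulr0 addr0.
by rewrite memvD // memvZ // memv_span // !inE eqxx ?orbT.
Qed.

End LowerBound.

(** * Numerical codes for legs *)

Section OccurrenceCode.
Variable P : presentation.

(** On plain numbers, free of bound proofs, the cyclic orders of legs can be evaluated. *)
Definition occ_code (o : occurrence P) : nat * nat := (val (tag o), val (tagged o)).

Lemma occ_code_inj : injective occ_code.
Proof.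
case=> r j [r' j'] [] /val_inj /= rr'; case: r' / rr' j' => j' jj'.
by congr (Tagged _ _); apply: val_inj.
Qed.

Lemma map_occ_code : map occ_code (enum {: occurrence P}) =
  flatten [seq [seq (val r, j) | j <- iota 0 (size (relator r))] | r <- enum 'I_(nrel P)].
Proof.
rewrite enumT [in LHS]unlock /= /tag_enum -enumT map_flatten -map_comp.
congr flatten; apply: eq_map => r /=.
by rewrite -val_enum_ord -!map_comp; apply: eq_map.
Qed.

Definition leg_code (l : leg P) : (nat * nat) * bool := (occ_code l.1, l.2).

Lemma leg_code_inj : injective leg_code.
Proof. by move=> [o b] [o' b'] [] /= rr jj ->; congr (_, _); apply: occ_code_inj; congr (_, _). Qed.

Lemma next_leg_code s (l : leg P) :
  leg_code (next_leg s l) = next (map leg_code (disc_legs s (disc_of l))) (leg_code l).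
Proof. by rewrite (next_map leg_code_inj) // uniq_disc_legs. Qed.

End OccurrenceCode.

(** * A presentation of the Klein four-group *)

Definition gx : 'I_2 := ord0.
Definition gy : 'I_2 := ord_max.

Definition klein_relators : seq (word 2) :=
  [:: [:: (gx, true); (gx, true)]; [:: (gy, true); (gy, true)];
      [:: (gx, true); (gy, true); (gx, true); (gy, true)]].

Definition klein_pres : presentation :=
  @Presentation 2 3 (fun r => nth [::] klein_relators r).

Local Notation P := klein_pres.

Definition klein_gen (i : 'I_2) : klein := if i == gx then (1, 0) else (0, 1).

Definition normal_word (x y : 'F_2) : word (ngen P) :=
  (if x == 0 then [::] else [:: (gx, true)]) ++ (if y == 0 then [::] else [:: (gy, true)]).

Lemma F2P (x : 'F_2) : x = 0 \/ x = 1.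
Proof. by case: x => [] [|[]] // ?; [left | right]; apply: val_inj. Qed.

Lemma ord2P (i : 'I_2) : i = gx \/ i = gy.
Proof. by case: i => [] [|[]] // ?; [left | right]; apply: val_inj. Qed.

Lemma pres_square (i : 'I_2) : @pres_eq P [:: (i, true); (i, true)] [::].
Proof.
case: (ord2P i) => ->.
  exact: (@pres_relator P (@Ordinal 3 0 isT)).
exact: (@pres_relator P (@Ordinal 3 1 isT)).
Qed.

Lemma pres_inverse (i : 'I_2) : @pres_eq P [:: (i, false)] [:: (i, true)].
Proof.
apply: (@pres_trans P _ ([:: (i, false)] ++ [:: (i, true); (i, true)])).
  exact: (@pres_cat P [:: (i, false)] _ [::] _ (@pres_refl P _) (pres_sym (pres_square i))).
exact: (@pres_cat P [:: (i, false); (i, true)] [::] _ _ (@pres_cancel P i false)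
         (@pres_refl P [:: (i, true)])).
Qed.

(** [yx = (xx) yx (yy) = x (xyxy) y = xy]. *)
Lemma pres_commute : @pres_eq P [:: (gy, true); (gx, true)] [:: (gx, true); (gy, true)].
Proof.
apply: (@pres_trans P _ ([:: (gx, true); (gx, true)] ++ [:: (gy, true); (gx, true)] ++
                          [:: (gy, true); (gy, true)])).
  exact/pres_sym/(pres_cat (pres_square gx) (pres_cat (@pres_refl P _) (pres_square gy))).
have xyxy := @pres_relator P (@Ordinal 3 2 isT).
exact: (@pres_cat P _ _ _ _ (@pres_refl P [:: (gx, true)])
         (@pres_cat P [:: (gx, true); (gy, true); (gx, true); (gy, true)] [::] _ _
            xyxy (@pres_refl P [:: (gy, true)]))).
Qed.

Local Definition coord1 (i : 'I_2) : 'F_2 := (klein_gen i).1.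
Local Definition coord2 (i : 'I_2) : 'F_2 := (klein_gen i).2.

(** The four normal forms are stable under prepending a letter, so words with equal coordinates are
    equal in the presented group. *)
Lemma pres_normal (w : word (ngen P)) :
  @pres_eq P w (normal_word (wsum coord1 w) (wsum coord2 w)).
Proof.
elim: w => [|[i e] w IHw]; first by rewrite /wsum !big_nil; apply: pres_refl.
rewrite /wsum !big_cons -!/(wsum _ _) /=.
have two0 := addF2 1; rewrite !(opp_char2 two0) !if_same.
apply: (@pres_trans P _ ([:: (i, true)] ++ normal_word (wsum coord1 w) (wsum coord2 w))).
  apply: (@pres_cat P [:: (i, e)] _ _ _ _ IHw).
  by case: e; [apply: pres_refl | apply: pres_inverse].
set x := wsum coord1 w; set y := wsum coord2 w.
have yy : @pres_eq P ([:: (gy, true)] ++ normal_word 0 y) (normal_word 0 (1 + y)).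
  case: (F2P y) => ->; first by rewrite addr0; apply: pres_refl.
  by rewrite addF2; apply: pres_square.
case: (ord2P i) => ->.
  rewrite (_ : coord1 gx = 1) // (_ : coord2 gx = 0) // add0r.
  case: (F2P x) => ->; first by rewrite addr0; apply: pres_refl.
  rewrite addF2; exact: (@pres_cat P [:: (gx, true); (gx, true)] [::] _ _ (pres_square gx)
                           (@pres_refl P _)).
rewrite (_ : coord1 gy = 0) // (_ : coord2 gy = 1) // add0r.
case: (F2P x) => ->; first exact: yy.
apply: (@pres_trans P _ ([:: (gx, true)] ++ ([:: (gy, true)] ++ normal_word 0 y))).
  exact: (@pres_cat P [:: (gy, true); (gx, true)] [:: (gx, true); (gy, true)] _ _
            pres_commute (@pres_refl P (normal_word 0 y))).
exact: (@pres_cat P _ _ _ _ (@pres_refl P [:: (gx, true)]) yy).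
Qed.

Lemma klein_presented : presents klein_pres klein.
Proof.
exists klein_gen; split=> [[x y] | u v].
  exists (normal_word x y); rewrite (@eval_klein P klein_gen) /wsum /normal_word.
  by case: (F2P x) => ->; case: (F2P y) => ->;
    rewrite /= ?big_cons !big_nil /= ?addr0 ?add0r.
rewrite !(@eval_klein P klein_gen); split=> [[uv1 uv2] | uv].
  apply: pres_trans (pres_normal u) _; apply: pres_sym; apply: pres_trans (pres_normal v) _.
  by rewrite /coord1 /coord2 uv1 uv2; apply: pres_refl.
by congr (_, _); apply: (@wsum_pres_eq _ P) uv => -[[|[|[]]] //= ?];
  rewrite /wsum /= !big_cons big_nil; apply: val_inj.
Qed.

(** * The upper bound: faces and connectedness for the unshuffled surface *)

Definition shuffle1 : shuffle P := fun i => 1%g.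

Lemma enum_klein_occ (i : 'I_2) :
  map (@occ_code P) (enum (@occ_of P i)) =
  if i == gx then [:: (0, 0); (0, 1); (2, 0); (2, 2)]%N
  else [:: (1, 0); (1, 1); (2, 1); (2, 3)]%N.
Proof.
pose let_code c := (nth (gx, true) (nth [::] klein_relators c.1) c.2).1 == i.
have -> : enum (@occ_of P i) = filter (let_code \o @occ_code P) (enum {: occurrence P}).
  rewrite enumT; apply: eq_filter => o; rewrite !inE /let_code /letter /=.
  by rewrite (tnth_nth (gx, true)).
rewrite -filter_map map_occ_code !enum_ordSl enum_ord0 /let_code.
by case: (ord2P i) => ->.
Qed.

Lemma card_klein_occurrences : #|{: occurrence P}| = 8.
Proof.
by rewrite cardE -(size_map (@occ_code P)) map_occ_code !enum_ordSl enum_ord0.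
Qed.

Lemma disc_legs_code (u : disc P) :
  map (@leg_code P) (disc_legs shuffle1 u) =
  let c := [seq (o, u.2) | o <- map (@occ_code P) (enum (occ_of u.1))] in
  if u.2 then c else rev c.
Proof.
case: u => i b; rewrite /disc_legs /= -/(nocc i).
have -> : [seq (occ_at (shuffle1 i p), b) | p <- enum 'I_(nocc i)] =
          [seq (o, b) | o <- enum (occ_of i)].
  rewrite -[in RHS](map_tnth_enum (enum_tuple (occ_of i))) -map_comp.
  apply: eq_map => p /=; congr (_, _); rewrite perm1 /occ_at.
  by rewrite (tnth_nth (enum_val p)) -enum_val_nth.
by case: b; rewrite ?map_rev -!map_comp.
Qed.

Definition klein_cycle (i : 'I_2) (b : bool) :=
  let c := [seq (o, b) | o <- if i == gx then [:: (0, 0); (0, 1); (2, 0); (2, 2)]%N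
                               else [:: (1, 0); (1, 1); (2, 1); (2, 3)]%N] in
  if b then c else rev c.

Lemma next_leg_klein (l : leg P) :
  leg_code (next_leg shuffle1 l) =
  next (klein_cycle (letter l.1).1 l.2) (leg_code l).
Proof. by rewrite next_leg_code disc_legs_code enum_klein_occ. Qed.

Definition klein_occ (r j : nat) (r_lt : (r < 3)%N)
    (j_lt : (j < size (nth [::] klein_relators r))%N) : occurrence P :=
  @occ P (Ordinal r_lt) (Ordinal j_lt).
Arguments klein_occ : clear implicits.

Lemma boundary_step_klein (l m : leg P) :
  next (klein_cycle (letter l.1).1 l.2) (leg_code l) = leg_code m ->
  boundary_step shuffle1 l = ribbon m.
Proof. by rewrite -next_leg_klein => /(@leg_code_inj P); rewrite /boundary_step => ->. Qed.

Local Definition x20 := klein_occ 2 0 isT isT.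
Local Definition y21 := klein_occ 2 1 isT isT.
Local Definition x22 := klein_occ 2 2 isT isT.
Local Definition y23 := klein_occ 2 3 isT isT.
Local Definition x00 := klein_occ 0 0 isT isT.
Local Definition y10 := klein_occ 1 0 isT isT.
Local Definition y11 := klein_occ 1 1 isT isT.

Lemma klein_digon : fcycle (boundary_step shuffle1) [:: (x20, true); (y23, false)].
Proof.
rewrite /= andbT; apply/andP; split; apply/eqP; apply: (@leg_code_inj P).
  by rewrite (@boundary_step_klein _ (x22, true)).
by rewrite (@boundary_step_klein _ (y21, false)).
Qed.

Lemma klein_quad : fcycle (boundary_step shuffle1)
  [:: (y11, true); (x22, false); (y23, true); (y11, false)].
Proof.
rewrite /= andbT; apply/and4P; split; apply/eqP; apply: (@leg_code_inj P).
- by rewrite (@boundary_step_klein _ (y21, true)).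
- by rewrite (@boundary_step_klein _ (x20, false)).
- by rewrite (@boundary_step_klein _ (y10, true)).
- by rewrite (@boundary_step_klein _ (y10, false)).
Qed.

(** The digon and the quadrilateral are two orbits, and [(x00, true)] lies on neither. *)
Lemma klein_faces : (3 <= fcard (boundary_step shuffle1) {: leg P})%N.
Proof.
set f := boundary_step _.
have f_sym : connect_sym (frel f).
  exact: fconnect_sym (inj_comp (inv_inj (@ribbonK P)) (@next_inj P shuffle1)).
have apart (p : seq (leg P)) l l' : fcycle f p -> leg_code l \in map (@leg_code P) p ->
    leg_code l' \notin map (@leg_code P) p -> froot f l != froot f l'.
  rewrite !(mem_map (@leg_code_inj P)) => p_cycle lp l'p.
  by rewrite root_connect // (fconnect_cycle p_cycle lp).
pose ls := [:: froot f (x20, true); froot f (y11, true); froot f (x00, true)].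
have ls_uniq : uniq ls.
  rewrite /= !inE !negb_or andbT; apply/andP; split; first (apply/andP; split).
  - exact: (apart _ _ _ klein_digon).
  - exact: (apart _ _ _ klein_digon).
  - exact: (apart _ _ _ klein_quad).
rewrite -[3%N]/(size ls) /n_comp_mem cardE; apply: uniq_leq_size ls_uniq _ => l.
rewrite mem_enum !inE andbT.
by case/or3P => /eqP ->; rewrite roots_root.
Qed.

Lemma klein_connected : (#|components P| <= 1)%N.
Proof.
pose adj := connect (@adjacent P).
have adj_sym : connect_sym (@adjacent P) := sym_connect_sym (@adjacent_sym P).
have step (l : leg P) : adj (disc_of l) (disc_of (ribbon l)).
  by apply: connect1; apply/existsP; exists l; rewrite !eqxx.
have xx : adj (gx, true) (gx, false) := step (x00, true).
have xy : adj (gx, true) (gy, false) := step (x20, true).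
have yx : adj (gy, true) (gx, false) := step (y21, true).
have base u : adj (gx, false) u.
  rewrite /adj adj_sym; case: u => i b; case: (ord2P i) => ->; case: b => //=.
  rewrite adj_sym; apply: connect_trans xy; by rewrite adj_sym.
rewrite -(cards1 [set: disc P]); apply/subset_leq_card/subsetP => C.
case/imsetP => w _ ->; rewrite inE; apply/eqP/setP => u; rewrite !inE /=.
apply: connect_trans (base u); rewrite adj_sym; exact: base.
Qed.

Lemma klein_genus_le1 : surface_genus shuffle1 <= 1.
Proof.
have := double_surface_genus shuffle1; rewrite card_klein_occurrences.
have := klein_connected; have := klein_faces.
(* The genus [g] satisfies [2 g <= 2 + 8 - 4 - 3 = 3], and it is an integer. *)
rewrite [ngen P]/= ; lia.
Qed.

Theorem theorem3 :
  exists G : groupType, finitely_presentable G /\ group_has_genus G 1%R.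
Proof.
exists klein; split; first by exists klein_pres; exact: klein_presented.
split; last by move=> P s [f [f_gen f_rel]]; apply: klein_genus_gt0 f_gen f_rel.
exists klein_pres, shuffle1; split; first exact: klein_presented.
apply/eqP; rewrite eq_le klein_genus_le1.
by have [f [f_gen f_rel]] := klein_presented; apply: klein_genus_gt0 f_gen f_rel.
Qed.
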